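(* $\mathsf{RCA}_0$ proves: every complete separable metric space which is Lebesgue is Atsuji.
   Context: Systems. $\mathsf{RCA}_0$ is the theory in the two-sorted language of second order arithmetic (number variables, set variables, $0,1,+,\cdot,=,<,\in$) consisting of the basic arithmetical axioms, induction for $\Sigma^0_1$ formulas and comprehension for $\Delta^0_1$ formulas. Spaces (definitions made in $\mathsf{RCA}_0$; reals are coded by rapidly converging Cauchy sequences of rationals). A (code for a) complete separable metric space $\widehat A$ is a set $A\subseteq\mathbb N$ together with $d:A\times A\to\mathbb R$ such that $d(a,a)=0$, $d(a,b)=d(b,a)\ge 0$, $d(a,b)\le d(a,c)+d(c,b)$ for all $a,b,c\in A$. A point of $\widehat A$ is a sequence $\langle a_n:n\in\mathbb N\rangle$ of elements of $A$ with $d(a_n,a_{n+1})<2^{-n}$ for all $n$; $d$ extends to points in the obvious way (also written $d_{\widehat A}$) and $x,y\in\widehat A$ are identified ($x=y$) when $d(x,y)=0$. $B(x,q)$ denotes the open ball $\{y\in\widehat A: d(x,y)<q\}$. An open set in $\widehat A$ is coded by a sequence $\langle (a_n,q_n):n\in\mathbb N\rangle$ of elements of $A\times\mathbb Q^+$ and means $\bigcup_n B(a_n,q_n)$. An open covering of $\widehat A$ is a sequence $\langle U_n:n\in\mathbb N\rangle$ of open sets such that every $x\in\widehat A$ belongs to some $U_n$. Lebesgue: $\widehat A$ is Lebesgue if for every open covering $\langle U_n:n\in\mathbb N\rangle$ of $\widehat A$ there is $q\in\mathbb R^+$ (a Lebesgue number for the covering) such that $\forall x\in\widehat A\,\exists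 n\ B(x,q)\subseteq U_n$. Continuous functions: a (code for a) continuous function from $\widehat A$ to $\widehat B$ is a set $\Phi\subseteq\mathbb N\times A\times\mathbb Q^+\times B\times\mathbb Q^+$ such that, writing $(a,r)\Phi(b,s)$ for $\exists n\,(n,a,r,b,s)\in\Phi$: (i) $(a,r)\Phi(b,s)\wedge(a,r)\Phi(b',s')\to d(b,b')<s+s'$; (ii) $(a,r)\Phi(b,s)\wedge d(b,b')+s\le s'\to(a,r)\Phi(b',s')$; (iii) $(a,r)\Phi(b,s)\wedge d(a,a')+r'\le r\to(a',r')\Phi(b,s)$; (iv) $\forall x\in\widehat A\,\forall q\in\mathbb Q^+\,\exists(a,r,b,s)\,((a,r)\Phi(b,s)\wedge d(x,a)<r\wedge s<q)$. For $x\in\widehat A$, $f(x)$ is the unique $y\in\widehat B$ with $d(y,b)<s$ whenever $d(x,a)<r$ and $(a,r)\Phi(b,s)$. The function $f$ is uniformly continuous if $\forall\varepsilon\in\mathbb R^+\,\exists\delta\in\mathbb R^+\,\forall x,y\in\widehat A\,(d_{\widehat A}(x,y)<\delta\to d_{\widehat B}(f(x),f(y))<\varepsilon)$. Atsuji: $\widehat A$ is Atsuji if every continuous function $f:\widehat A\to\widehat B$, with $\widehat B$ an arbitrary complete separable metric space, is uniformly continuous. *)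

(* Defs.v *)
From Stdlib Require List.
From mathcomp Require Import ssreflect ssrfun ssrbool eqtype ssrnat seq.

Set Implicit Arguments.
Unset Strict Implicit.
Unset Printing Implicit Defensive.

(** * Second order arithmetic

    Two-sorted syntax with de Bruijn indices; number variables and set
    variables are indexed separately.  The primitive connectives are falsum,
    implication and the two universal quantifiers; the logic is classical and
    the other connectives are the usual abbreviations. *)

Inductive tm : Type :=
| Var of nat
| Zero
| One
| Plus of tm & tm
| Mult of tm & tm.

Inductive form : Type :=
| Eq of tm & tm
| Lt of tm & tm
| In of tm & nat
| Bot
| Imp of form & form
| All1 of form
| All2 of form.

Definition Neg p := Imp p Bot.
Definition Or p q := Imp (Neg p) q.
Definition And p q := Neg (Imp p (Neg q)).
Definition Iff p q := And (Imp p q) (Imp q p).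
Definition Ex1 p := Neg (All1 (Neg p)).
Definition Ex2 p := Neg (All2 (Neg p)).

(** Simultaneous capture-avoiding substitution: number variables are replaced
    by terms, set variables by set variables. *)

Fixpoint tsubst (s : nat -> tm) (t : tm) : tm :=
  match t with
  | Var x => s x
  | Zero => Zero
  | One => One
  | Plus t u => Plus (tsubst s t) (tsubst s u)
  | Mult t u => Mult (tsubst s t) (tsubst s u)
  end.

Definition tshift : tm -> tm := tsubst (fun x => Var x.+1).

Definition scons (T : Type) (a : T) (s : nat -> T) (x : nat) : T :=
  if x is y.+1 then s y else a.

Definition up1 (s : nat -> tm) : nat -> tm :=
  scons (Var 0) (fun x => tshift (s x)).
Definition up2 (r : nat -> nat) : nat -> nat := scons 0 (fun x => (r x).+1).

Fixpoint fsubst (s : nat -> tm) (r : nat -> nat) (p : form) : form :=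
  match p with
  | Eq t u => Eq (tsubst s t) (tsubst s u)
  | Lt t u => Lt (tsubst s t) (tsubst s u)
  | In t X => In (tsubst s t) (r X)
  | Bot => Bot
  | Imp p q => Imp (fsubst s r p) (fsubst s r q)
  | All1 p => All1 (fsubst (up1 s) r p)
  | All2 p => All2 (fsubst s (up2 r) p)
  end.

Definition shift1 : form -> form := fsubst (fun x => Var x.+1) id.
Definition shift2 : form -> form := fsubst Var succn.
Definition inst1 (t : tm) : form -> form := fsubst (scons t Var) id.
Definition inst2 (X : nat) : form -> form := fsubst Var (scons X id).

(** Classical natural deduction for two-sorted first order logic with equality
    on numbers.  The free variables of an axiom in [T] are parameters: they
    are read as universally quantified. *)

Inductive prv (T : form -> Prop) : seq form -> form -> Prop :=
| prv_ax G p : T p -> prv T G p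
| prv_hyp G p : List.In p G -> prv T G p
| prv_impI G p q : prv T (p :: G) q -> prv T G (Imp p q)
| prv_impE G p q : prv T G (Imp p q) -> prv T G p -> prv T G q
| prv_raa G p : prv T (Neg p :: G) Bot -> prv T G p
| prv_all1I G p : prv T (map shift1 G) p -> prv T G (All1 p)
| prv_all1E G p t : prv T G (All1 p) -> prv T G (inst1 t p)
| prv_all2I G p : prv T (map shift2 G) p -> prv T G (All2 p)
| prv_all2E G p X : prv T G (All2 p) -> prv T G (inst2 X p)
| prv_eqI G t : prv T G (Eq t t)
| prv_eqE G t u p : prv T G (Eq t u) -> prv T G (inst1 t p) ->
    prv T G (inst1 u p).

(** * Concrete formulas

    To write formulas with named bound variables, a term (set, formula) is
    represented by a function of the number of number variables and the number
    of set variables bound so far; a bound variable is turned into the de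
    Bruijn index appropriate to the place where it is used.  A closed formula
    [p : fm] denotes the sentence [p 0 0]. *)

Definition num := nat -> tm.
Definition nset := nat -> nat.
Definition fm := nat -> nat -> form.

Declare Scope num_scope.
Delimit Scope num_scope with num.
Bind Scope num_scope with num.
Declare Scope fm_scope.
Delimit Scope fm_scope with fm.
Bind Scope fm_scope with fm.

Definition n0 : num := fun _ => Zero.
Definition n1 : num := fun _ => One.
Definition nadd (x y : num) : num := fun i => Plus (x i) (y i).
Definition nmul (x y : num) : num := fun i => Mult (x i) (y i).

Notation "0" := n0 : num_scope.
Notation "1" := n1 : num_scope.
Notation "x + y" := (nadd x y) : num_scope.
Notation "x * y" := (nmul x y) : num_scope.
Notation "2" := (1 + 1)%num : num_scope.
Notation "4" := (2 + 2)%num : num_scope.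

Definition fEq (x y : num) : fm := fun i j => Eq (x i) (y i).
Definition fLt (x y : num) : fm := fun i j => Lt (x i) (y i).
Definition fIn (x : num) (X : nset) : fm := fun i j => In (x i) (X j).
Definition fBot : fm := fun i j => Bot.
Definition fNeg (p : fm) : fm := fun i j => Neg (p i j).
Definition fImp (p q : fm) : fm := fun i j => Imp (p i j) (q i j).
Definition fAnd (p q : fm) : fm := fun i j => And (p i j) (q i j).
Definition fOr (p q : fm) : fm := fun i j => Or (p i j) (q i j).
Definition fIff (p q : fm) : fm := fun i j => Iff (p i j) (q i j).

Definition nvar (i : nat) : num := fun i' => Var (i' - i.+1).
Definition svar (j : nat) : nset := fun j' => j' - j.+1.

Definition fAll1 (F : num -> fm) : fm := fun i j => All1 (F (nvar i) i.+1 j).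
Definition fEx1 (F : num -> fm) : fm := fun i j => Ex1 (F (nvar i) i.+1 j).
Definition fAll2 (F : nset -> fm) : fm := fun i j => All2 (F (svar j) i j.+1).
Definition fEx2 (F : nset -> fm) : fm := fun i j => Ex2 (F (svar j) i j.+1).

Notation "x = y" := (fEq x%num y%num) : fm_scope.
Notation "x < y" := (fLt x%num y%num) : fm_scope.
Notation "x \in X" := (fIn x%num X) : fm_scope.
Notation "~ p" := (fNeg p) : fm_scope.
Notation "p /\ q" := (fAnd p q) : fm_scope.
Notation "p \/ q" := (fOr p q) : fm_scope.
Notation "p ⇒ q" := (fImp p q) (at level 90, right associativity) : fm_scope.
Notation "p ⇔ q" := (fIff p q) (at level 95, no associativity) : fm_scope.
Notation "'ALL1' x .. y , p" := (fAll1 (fun x => .. (fAll1 (fun y => p%fm)) ..))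
  (at level 200, x binder, y binder, right associativity) : fm_scope.
Notation "'EX1' x .. y , p" := (fEx1 (fun x => .. (fEx1 (fun y => p%fm)) ..))
  (at level 200, x binder, y binder, right associativity) : fm_scope.
Notation "'ALL2' x .. y , p" := (fAll2 (fun x => .. (fAll2 (fun y => p%fm)) ..))
  (at level 200, x binder, y binder, right associativity) : fm_scope.
Notation "'EX2' x .. y , p" := (fEx2 (fun x => .. (fEx2 (fun y => p%fm)) ..))
  (at level 200, x binder, y binder, right associativity) : fm_scope.

(** * The theory RCA0 *)

(** Bounded quantification over [x < t], with [t] not containing [x]; the
    bounded existential quantifier is obtained by negation. *)
Inductive Delta00 : form -> Prop :=
| Delta00_eq t u : Delta00 (Eq t u)
| Delta00_lt t u : Delta00 (Lt t u)
| Delta00_in t X : Delta00 (In t X)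
| Delta00_bot : Delta00 Bot
| Delta00_imp p q : Delta00 p -> Delta00 q -> Delta00 (Imp p q)
| Delta00_all t p : Delta00 p -> Delta00 (All1 (Imp (Lt (Var 0) (tshift t)) p)).

Definition Sigma01 (p : form) : Prop := exists2 q, Delta00 q & p = Ex1 q.
Definition Pi01 (p : form) : Prop := exists2 q, Delta00 q & p = All1 q.

Section BasicTheory.
Local Open Scope fm_scope.

Definition basic_axioms : seq fm :=
  [:: (ALL1 n, ~ (n + 1 = 0));
      (ALL1 m n, m + 1 = n + 1 ⇒ m = n);
      (ALL1 m, m + 0 = m);
      (ALL1 m n, m + (n + 1) = (m + n) + 1);
      (ALL1 m, m * 0 = 0);
      (ALL1 m n, m * (n + 1) = (m * n) + m);
      (ALL1 m, ~ (m < 0));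
      (ALL1 m n, m < n + 1 ⇔ (m < n \/ m = n)) ].

End BasicTheory.

(** In the two schemes the distinguished number variable [n] is [Var 0]. *)

Definition induction_axiom (p : form) : form :=
  Imp (And (inst1 Zero p)
           (All1 (Imp p (fsubst (scons (Plus (Var 0) One) (fun x => Var x.+1))
                                id p))))
      (All1 p).

Definition comprehension_axiom (p q : form) : form :=
  Imp (All1 (Iff p q)) (Ex2 (All1 (Iff (In (Var 0) 0) (shift2 p)))).

Inductive RCA0 : form -> Prop :=
| RCA0_basic p : List.In p basic_axioms -> RCA0 (p 0 0)
| RCA0_induction p : Sigma01 p -> RCA0 (induction_axiom p)
| RCA0_comprehension p q : Sigma01 p -> Pi01 q ->
    RCA0 (comprehension_axiom p q).

Definition RCA0_proves (p : fm) : Prop := prv RCA0 [::] (p 0 0).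

(** * Coding in second order arithmetic *)

Local Open Scope fm_scope.

Definition fTrue : fm := fBot ⇒ fBot.

Definition fLe (x y : num) : fm := x < y \/ x = y.
Notation "x <= y" := (fLe x%num y%num) : fm_scope.

Definition npair (x y : num) : num := ((x + y) * (x + y) + x)%num.
Notation "⟨ x , y , .. , z ⟩" := (npair .. (npair x%num y%num) .. z%num)
  (at level 0) : num_scope.

(** [F] is (the graph of) a function from [Dom] to [Cod]. *)
Definition IsFun (F : nset) (Dom Cod : num -> fm) : fm :=
  (ALL1 z, z \in F ⇒ EX1 x y, z = ⟨x, y⟩ /\ Dom x /\ Cod y)
  /\ (ALL1 x, Dom x ⇒ EX1 y, ⟨x, y⟩ \in F)
  /\ (ALL1 x y y', ⟨x, y⟩ \in F ⇒ ⟨x, y'⟩ \in F ⇒ y = y').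

Definition IsNat (x : num) : fm := fTrue.

(** [e] is [2 ^ k], as a value of the function defined by primitive
    recursion. *)
Definition Pow2 (k e : num) : fm :=
  EX2 E, IsFun E IsNat IsNat /\ ⟨0, 1⟩ \in E
    /\ (ALL1 i j, ⟨i, j⟩ \in E ⇒ ⟨i + 1, 2 * j⟩ \in E)
    /\ ⟨k, e⟩ \in E.

(** ** Rationals

    The triple [(m, n, p)] with [0 < p] stands for [(m - n) / p].  A rational
    has several codes; equality and order of rationals are those induced by
    this reading. *)

Record rat := Rat { rpos : num; rneg : num; rden : num }.

Definition rcode (u : rat) : num := ⟨rpos u, rneg u, rden u⟩%num.
Definition ratP (u : rat) : fm := 0 < rden u.
Definition rat_posP (u : rat) : fm := 0 < rden u /\ rneg u < rpos u.

Definition rat_add (u v : rat) : rat :=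
  Rat (rpos u * rden v + rpos v * rden u)
      (rneg u * rden v + rneg v * rden u)
      (rden u * rden v).
Definition rat_le (u v : rat) : fm :=
  rpos u * rden v + rneg v * rden u <= rpos v * rden u + rneg u * rden v.
Definition rat_lt (u v : rat) : fm :=
  rpos u * rden v + rneg v * rden u < rpos v * rden u + rneg u * rden v.

Definition rat_frac (m p : num) : rat := Rat m 0 p.

Definition ExQ (F : rat -> fm) : fm :=
  EX1 m n p, ratP (Rat m n p) /\ F (Rat m n p).
Definition ExQpos (F : rat -> fm) : fm :=
  EX1 m n p, rat_posP (Rat m n p) /\ F (Rat m n p).
Definition AllQpos (F : rat -> fm) : fm :=
  ALL1 m n p, rat_posP (Rat m n p) ⇒ F (Rat m n p).

Definition IsQ (x : num) : fm := ExQ (fun u => x = rcode u).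
Definition IsQpos (x : num) : fm := ExQpos (fun u => x = rcode u).

(** ** Reals

    A real is a sequence of rationals with [|q_k - q_(k+i)| <= 2^-k].  A real
    may be given by a set or be an entry of a coded sequence of reals, a sum,
    or the distance of two points; it is therefore represented by the
    operation which, given [k] and a property [F] of rationals, returns the
    formula "the [k]-th approximation satisfies [F]". *)

Definition real := num -> (rat -> fm) -> fm.

Definition real_of_set (X : nset) : real :=
  fun k F => ExQ (fun u => ⟨k, rcode u⟩ \in X /\ F u).
Definition real_of_rat (u : rat) : real := fun k F => F u.
Definition real0 : real := real_of_rat (rat_frac 0 1).
Definition real_add (x y : real) : real :=
  fun k F => x (k + 1)%num (fun u => y (k + 1)%num (fun v => F (rat_add u v))).

Definition RapidlyConverging (x : real) : fm :=
  ALL1 k i, EX1 e, Pow2 k e /\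
    x k (fun u => x (k + i)%num (fun v =>
      rat_le u (rat_add v (rat_frac 1 e)) /\
      rat_le v (rat_add u (rat_frac 1 e)))).

Definition IsReal (X : nset) : fm :=
  IsFun X IsNat IsQ /\ RapidlyConverging (real_of_set X).

(** [x <= y] iff [x_k <= y_k + 2 * 2^-k] for all [k]. *)
Definition real_le (x y : real) : fm :=
  ALL1 k, EX1 e, Pow2 k e /\
    x k (fun u => y k (fun v => rat_le u (rat_add v (rat_frac 2 e)))).
Definition real_lt (x y : real) : fm := ~ real_le y x.
Definition real_eq (x y : real) : fm := real_le x y /\ real_le y x.

Definition AllRpos (F : real -> fm) : fm :=
  ALL2 X, IsReal X ⇒ real_lt real0 (real_of_set X) ⇒ F (real_of_set X).
Definition ExRpos (F : real -> fm) : fm :=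
  EX2 X, IsReal X /\ real_lt real0 (real_of_set X) /\ F (real_of_set X).

(** ** Complete separable metric spaces

    [d : A * A -> R] is coded as a sequence of reals indexed by [A * A], i.e.
    as a function from [(A * A) * N] to the rationals. *)

Definition mdist (d : nset) (a b : num) : real :=
  fun k F => ExQ (fun u => ⟨⟨a, b⟩, k, rcode u⟩ \in d /\ F u).

Definition IsSpace (A d : nset) : fm :=
  IsFun d (fun z => EX1 a b k, z = ⟨a, b, k⟩ /\ a \in A /\ b \in A) IsQ
  /\ (ALL1 a b, a \in A ⇒ b \in A ⇒ RapidlyConverging (mdist d a b))
  /\ (ALL1 a, a \in A ⇒ real_eq (mdist d a a) real0)
  /\ (ALL1 a b, a \in A ⇒ b \in A ⇒
        real_eq (mdist d a b) (mdist d b a) /\ real_le real0 (mdist d a b))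
  /\ (ALL1 a b c, a \in A ⇒ b \in A ⇒ c \in A ⇒
        real_le (mdist d a b) (real_add (mdist d a c) (mdist d c b))).

Definition IsPoint (A d X : nset) : fm :=
  IsFun X IsNat (fun a => a \in A)
  /\ (ALL1 n a b, ⟨n, a⟩ \in X ⇒ ⟨n + 1, b⟩ \in X ⇒
        EX1 e, Pow2 n e /\
          real_lt (mdist d a b) (real_of_rat (rat_frac 1 e))).

(** As for reals, a point is represented by the operation which, given [k] and
    [F], returns the formula "the [k]-th term satisfies [F]"; an element of
    [A] is identified with the corresponding constant sequence. *)

Definition point := num -> (num -> fm) -> fm.

Definition point_of_set (X : nset) : point :=
  fun k F => EX1 a, ⟨k, a⟩ \in X /\ F a.
Definition point_of_elt (a : num) : point := fun k F => F a.

(** The distance [lim_k d (x_k, y_k)]: the indices [k + 4] and [k + 2] make the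
    sequence of rationals satisfy [|q_k - q_(k+i)| <= 2^-k], because
    [|d (x_n, y_n) - d (x, y)| <= 4 * 2^-n]. *)
Definition pdist (d : nset) (x y : point) : real :=
  fun k F => x (k + 4)%num (fun a => y (k + 4)%num (fun b =>
    mdist d a b (k + 2)%num F)).

Definition AllPt (A d : nset) (F : point -> fm) : fm :=
  ALL2 X, IsPoint A d X ⇒ F (point_of_set X).

(** ** Open coverings and the Lebesgue property

    A sequence of open sets [U_n], each coded by a sequence
    [((a_nk, q_nk))_k] of elements of [A * Q+], is coded as a function from
    [N * N] to [A * Q+]. *)

Definition IsOpenSeq (A U : nset) : fm :=
  IsFun U (fun z => EX1 n k, z = ⟨n, k⟩)
          (fun z => EX1 a q, z = ⟨a, q⟩ /\ a \in A /\ IsQpos q).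

Definition InOpen (d U : nset) (n : num) (x : point) : fm :=
  EX1 k a, ExQpos (fun q => ⟨⟨n, k⟩, ⟨a, rcode q⟩⟩ \in U
    /\ real_lt (pdist d x (point_of_elt a)) (real_of_rat q)).

Definition IsOpenCover (A d U : nset) : fm :=
  IsOpenSeq A U /\ AllPt A d (fun x => EX1 n, InOpen d U n x).

Definition Lebesgue (A d : nset) : fm :=
  ALL2 U, IsOpenCover A d U ⇒
    ExRpos (fun q =>
      AllPt A d (fun x => EX1 n,
        AllPt A d (fun y => real_lt (pdist d x y) q ⇒ InOpen d U n y))).

(** ** Continuous functions and the Atsuji property *)

(** [(a, r) P (b, s)] for a code [P]. *)
Definition CodeRel (P : nset) (a : num) (r : rat) (b : num) (s : rat) : fm :=
  EX1 n, ⟨n, a, rcode r, b, rcode s⟩ \in P.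

(** Clauses (ii) and (iii) range over elements [b'] of [B], [a'] of [A] and
    positive rationals [s'], [r']. *)
Definition IsContFun (A d B d' P : nset) : fm :=
  (ALL1 z, z \in P ⇒ EX1 n a r b s, z = ⟨n, a, r, b, s⟩
      /\ a \in A /\ IsQpos r /\ b \in B /\ IsQpos s)
  /\ (ALL1 a b b', AllQpos (fun r => AllQpos (fun s => AllQpos (fun s' =>
        CodeRel P a r b s ⇒ CodeRel P a r b' s' ⇒
        real_lt (mdist d' b b') (real_of_rat (rat_add s s'))))))
  /\ (ALL1 a b b', AllQpos (fun r => AllQpos (fun s => AllQpos (fun s' =>
        b' \in B ⇒ CodeRel P a r b s ⇒
        real_le (real_add (mdist d' b b') (real_of_rat s)) (real_of_rat s') ⇒
        CodeRel P a r b' s'))))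
  /\ (ALL1 a a' b, AllQpos (fun r => AllQpos (fun r' => AllQpos (fun s =>
        a' \in A ⇒ CodeRel P a r b s ⇒
        real_le (real_add (mdist d a a') (real_of_rat r')) (real_of_rat r) ⇒
        CodeRel P a' r' b s))))
  /\ AllPt A d (fun x => AllQpos (fun q =>
        EX1 a b, ExQpos (fun r => ExQpos (fun s =>
          CodeRel P a r b s
          /\ real_lt (pdist d x (point_of_elt a)) (real_of_rat r)
          /\ rat_lt s q)))).

(** [f (x) = y], where [f] is the function coded by [P]; [y] is determined up
    to [d' (y, y') = 0]. *)
Definition IsValue (d d' P : nset) (x y : point) : fm :=
  ALL1 a b, AllQpos (fun r => AllQpos (fun s =>
    CodeRel P a r b s ⇒
    real_lt (pdist d x (point_of_elt a)) (real_of_rat r) ⇒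
    real_lt (pdist d' y (point_of_elt b)) (real_of_rat s))).

(** The descriptions [f (x)] and [f (y)] are eliminated by quantifying over all
    points of the target satisfying them. *)
Definition UnifCont (A d B d' P : nset) : fm :=
  AllRpos (fun eps => ExRpos (fun delta =>
    AllPt A d (fun x => AllPt A d (fun y =>
      AllPt B d' (fun fx => AllPt B d' (fun fy =>
        IsValue d d' P x fx ⇒ IsValue d d' P y fy ⇒
        real_lt (pdist d x y) delta ⇒ real_lt (pdist d' fx fy) eps)))))).

Definition Atsuji (A d : nset) : fm :=
  ALL2 B d', IsSpace B d' ⇒
    ALL2 P, IsContFun A d B d' P ⇒ UnifCont A d B d' P.

(* Main.v *)
From HB Require Import structures.
From mathcomp Require Import all_boot all_order all_algebra.
From mathcomp Require Import boolp ring lra.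
Require Import Defs.

(* By Gödel's completeness theorem for the two-sorted calculus, it suffices to
   argue in an arbitrary model of RCA0. Its numbers form an ordered semiring,
   whose fractions form an ordered field; codes of rationals become elements of
   this field and inequalities between reals become statements about
   approximations up to the field elements 2 ^ -k.

   Given a code P of a continuous function and eps > 0, pick a rational q0 with
   2 q0 < eps, and let U_m be the ball B(a, r) if m = (n, a, r, b, s) belongs to
   P and s < q0, and a fixed ball of this kind otherwise. These balls cover the
   space, and a Lebesgue number delta of the covering witnesses uniform
   continuity: if d(x, y) < delta then x and y lie in one ball B(a, r), so f(x)
   and f(y) are at distance < s < q0 of the same b. The covering exists by
   Delta^0_0 comprehension; Sigma^0_1 induction gives the properties of 2 ^ k
   and the bound d(x_n, x_(n+i)) < 2 * 2 ^ -n for points. *)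

Set Implicit Arguments.
Unset Strict Implicit.
Unset Printing Implicit Defensive.
Import Order.TTheory GRing.Theory Num.Theory.

(** * Syntax *)

(** The model may be nonstandard, so induction and comprehension are available only for formulas
    exhibited as syntax. Inductive properties are therefore brought into the form of at most one
    unbounded existential quantifier before a bounded matrix; [isDelta00] checks the matrix by
    computation, and [holds] makes its reading convertible to the mathematical statement. Distances
    are compared through strict inequalities: d(a, b) < c says that some approximation witnesses it,
    hence is existential, whereas d(a, b) <= c is universal. The axioms of a space speak of elements
    of A only, so facts about points are obtained at terms far along the sequences, with a margin
    that absorbs the errors of approximation. Each U_m is a single ball, so two points of U_m share
    a and r, hence also b and s. The fixed ball is there because a coded sequence of open sets is a
    total function, also at numbers m that code no suitable entry of P. The margin 2 q0 < eps comes
    from the triangle inequality through b, applied to terms of the sequences f(x) and f(y). *)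

Lemma tsubst_comp s s' t :
  tsubst s' (tsubst s t) = tsubst (fun x => tsubst s' (s x)) t.
Proof. by elim: t => //= t -> u ->. Qed.

Lemma tsubst_id t : tsubst Var t = t.
Proof. by elim: t => //= t -> u ->. Qed.

Lemma up1_comp s s' :
  up1 (fun x => tsubst s' (s x)) = fun x => tsubst (up1 s') (up1 s x).
Proof. by apply/funext => -[|x] //=; rewrite /tshift !tsubst_comp. Qed.

Lemma up2_comp r r' : up2 (fun x => r' (r x)) = fun x => up2 r' (up2 r x).
Proof. by apply/funext => -[]. Qed.

Lemma fsubst_comp s r s' r' p :
  fsubst s' r' (fsubst s r p) =
  fsubst (fun x => tsubst s' (s x)) (fun x => r' (r x)) p.
Proof.
elim: p s r s' r' => /= [t u|t u|t X||p IHp q IHq|p IH|p IH] s r s' r' //;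
  rewrite ?tsubst_comp ?IHp ?IHq ?IH //.
- by rewrite -up1_comp.
- rewrite -up2_comp; congr (All2 (fsubst _ _ _)).
Qed.

Lemma fsubst_id p : fsubst Var id p = p.
Proof.
elim: p => /= [t u|t u|t X||p -> q ->|p IH|p IH] //; rewrite ?tsubst_id //.
- by rewrite (_ : up1 Var = Var) ?IH //; apply/funext => -[].
- by rewrite (_ : up2 id = id) ?IH //; apply/funext => -[].
Qed.

Lemma fsubst_inst1 s r t p :
  fsubst s r (inst1 t p) = inst1 (tsubst s t) (fsubst (up1 s) r p).
Proof.
rewrite /inst1 !fsubst_comp; congr fsubst; apply/funext => -[|x] //=.
by rewrite /tshift tsubst_comp tsubst_id.
Qed.

Lemma fsubst_inst2 s r X p :
  fsubst s r (inst2 X p) = inst2 (r X) (fsubst s (up2 r) p).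
Proof.
rewrite /inst2 !fsubst_comp; congr fsubst; last by apply/funext => -[].
by apply/funext => x /=; rewrite tsubst_id.
Qed.

Lemma fsubst_shift1 s r p :
  fsubst (up1 s) r (shift1 p) = shift1 (fsubst s r p).
Proof. by rewrite /shift1 !fsubst_comp. Qed.

Lemma fsubst_shift2 s r p :
  fsubst s (up2 r) (shift2 p) = shift2 (fsubst s r p).
Proof.
rewrite /shift2 !fsubst_comp; congr fsubst.
by apply/funext => x /=; rewrite tsubst_id.
Qed.

Lemma In_mapP (A B : Type) (f : A -> B) (s : seq A) y :
  List.In y (map f s) <-> exists2 x, List.In x s & f x = y.
Proof.
elim: s => [|a s IH] /=; first by split=> // -[].
split=> [[<-|/IH[x xs <-]]|[x [<-|xs] fx]]; first by exists a; [left|].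
- by exists x; [right|].
- by left.
- by right; apply/IH; exists x.
Qed.

(** * Weakening and substitution in derivations *)

Section Derivations.
Variable T : form -> Prop.

Lemma prv_weak G G' p :
  (forall q, List.In q G -> List.In q G') -> prv T G p -> prv T G' p.
Proof.
move=> sub H; elim: H G' sub => {G p}.
- by move=> G p Tp G' _; apply: prv_ax.
- by move=> G p Gp G' sub; apply/prv_hyp/sub.
- move=> G p q _ IH G' sub; apply/prv_impI/IH => x [<-|/sub]; by [left|right].
- move=> G p q _ IH1 _ IH2 G' sub; exact: prv_impE (IH1 _ sub) (IH2 _ sub).
- move=> G p _ IH G' sub; apply/prv_raa/IH => x [<-|/sub]; by [left|right].
- move=> G p _ IH G' sub; apply/prv_all1I/IH => x /In_mapP[y /sub yG <-].
  by apply/In_mapP; exists y.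
- by move=> G p t _ IH G' sub; apply/prv_all1E/IH.
- move=> G p _ IH G' sub; apply/prv_all2I/IH => x /In_mapP[y /sub yG <-].
  by apply/In_mapP; exists y.
- by move=> G p X _ IH G' sub; apply/prv_all2E/IH.
- by move=> G t G' _; apply: prv_eqI.
- move=> G t u p _ IH1 _ IH2 G' sub; exact: prv_eqE (IH1 _ sub) (IH2 _ sub).
Qed.

Lemma prv_cons G p q : prv T G p -> prv T (q :: G) p.
Proof. by apply: prv_weak => x; right. Qed.

Lemma prv_efq G p : prv T G Bot -> prv T G p.
Proof. by move=> H; apply/prv_raa/prv_cons. Qed.

Lemma prv_hyp0 G p : prv T (p :: G) p.
Proof. by apply: prv_hyp; left. Qed.

Hypothesis Tsubst : forall s r p, T p -> T (fsubst s r p).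

(** Free variables of axioms are parameters, hence the closure hypothesis [Tsubst]. The result lets
    a variable that is absent from the hypotheses be renamed to the bound one. *)
Lemma prv_subst s r G p :
  prv T G p -> prv T (map (fsubst s r) G) (fsubst s r p).
Proof.
move=> H; elim: H s r => {G p}.
- by move=> G p Tp s r; apply/prv_ax/Tsubst.
- by move=> G p Gp s r; apply/prv_hyp/In_mapP; exists p.
- by move=> G p q _ IH s r; apply/prv_impI/IH.
- by move=> G p q _ IH1 _ IH2 s r; apply: prv_impE (IH1 _ _) (IH2 _ _).
- by move=> G p _ IH s r; apply/prv_raa/IH.
- move=> G p _ IH s r; apply/prv_all1I; move: (IH (up1 s) r).
  rewrite -!map_comp; congr (prv _ (map _ _) _); apply/funext => q /=.
  by rewrite fsubst_shift1.
- by move=> G p t _ IH s r; rewrite fsubst_inst1; apply/prv_all1E/IH.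
- move=> G p _ IH s r; apply/prv_all2I; move: (IH s (up2 r)).
  rewrite -!map_comp; congr (prv _ (map _ _) _); apply/funext => q /=.
  by rewrite fsubst_shift2.
- by move=> G p X _ IH s r; rewrite fsubst_inst2; apply/prv_all2E/IH.
- by move=> G t s r; apply: prv_eqI.
- move=> G t u p _ IH1 _ IH2 s r; rewrite fsubst_inst1.
  by apply: prv_eqE (IH1 _ _) _; rewrite -fsubst_inst1.
Qed.
End Derivations.

(** * Completeness *)
(** A class is given by its predicate, so extensionality turns related elements into equal classes.
    The construction serves both the term model and the field of fractions. *)
Definition quot (T : Type) (R : T -> T -> Prop) :=
  {P : T -> Prop | exists x, P = R x}.
Definition qcl (T : Type) (R : T -> T -> Prop) (x : T) : quot R :=
  exist _ (R x) (ex_intro _ x erefl).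
Definition qrep (T : Type) (R : T -> T -> Prop) (q : quot R) : T :=
  sval (cid (svalP q)).

Lemma qrepK (T : Type) (R : T -> T -> Prop) : cancel (@qrep T R) (@qcl T R).
Proof.
by move=> q; rewrite /qrep; case: cid => x; case: q => P hP /= E; exact:
  eq_exist.
Qed.

Lemma qclE (T : Type) (R : T -> T -> Prop) :
  (forall x, R x x) -> (forall x y, R x y -> R y x) ->
  (forall x y z, R x y -> R y z -> R x z) ->
  forall x y, qcl R x = qcl R y <-> R x y.
Proof.
move=> refl sym trans x y; split=> [[->]//|xy]; apply: eq_exist.
by apply/funext => z; apply/propext; split; apply: trans => //; apply: sym.
Qed.

Record structure := Structure {
  dom : Type;
  sets : Type;
  dzero : dom;
  dunit : dom;
  dadd : dom -> dom -> dom;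
  dmul : dom -> dom -> dom;
  dlt : dom -> dom -> Prop;
  dmem : dom -> sets -> Prop
}.
Arguments dzero {_}.
Arguments dunit {_}.
Arguments dadd {_}.
Arguments dmul {_}.
Arguments dlt {_}.
Arguments dmem {_}.

Fixpoint teval (M : structure) (e : nat -> dom M) (t : tm) : dom M :=
  match t with
  | Var x => e x
  | Zero => dzero
  | One => dunit
  | Plus t u => dadd (teval e t) (teval e u)
  | Mult t u => dmul (teval e t) (teval e u)
  end.

Fixpoint sat (M : structure) (e : nat -> dom M) (f : nat -> sets M) (p : form)
    : Prop :=
  match p with
  | Eq t u => teval e t = teval e u
  | Lt t u => dlt (teval e t) (teval e u)
  | In t X => dmem (teval e t) (f X)
  | Bot => False
  | Imp p q => sat e f p -> sat e f q
  | All1 p => forall a, sat (scons a e) f p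
  | All2 p => forall X, sat e (scons X f) p
  end.

Definition model (T : form -> Prop) (M : structure) :=
  forall p, T p -> forall (e : nat -> dom M) f, sat e f p.

Lemma teval_subst M (e : nat -> dom M) s t :
  teval e (tsubst s t) = teval (fun x => teval e (s x)) t.
Proof. by elim: t => //= t -> u ->. Qed.

Lemma sat_subst M (e : nat -> dom M) f s r p :
  sat e f (fsubst s r p) = sat (fun x => teval e (s x)) (fun X => f (r X)) p.
Proof.
elim: p e f s r => /= [t u|t u|t X||p IHp q IHq|p IH|p IH] e f s r //;
  rewrite ?teval_subst ?IHp ?IHq //.
- apply: eq_forall => a; rewrite IH; congr sat; apply/funext => -[|x] //=.
  by rewrite /tshift teval_subst.
- by apply: eq_forall => X; rewrite IH; congr sat; apply/funext => -[].
Qed.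

Fixpoint tm_tree (t : tm) : GenTree.tree nat :=
  match t with
  | Var x => GenTree.Leaf x
  | Zero => GenTree.Node 0 [::]
  | One => GenTree.Node 1 [::]
  | Plus t u => GenTree.Node 2 [:: tm_tree t; tm_tree u]
  | Mult t u => GenTree.Node 3 [:: tm_tree t; tm_tree u]
  end.

Fixpoint form_tree (p : form) : GenTree.tree nat :=
  match p with
  | Eq t u => GenTree.Node 0 [:: tm_tree t; tm_tree u]
  | Lt t u => GenTree.Node 1 [:: tm_tree t; tm_tree u]
  | In t X => GenTree.Node 2 [:: tm_tree t; GenTree.Leaf X]
  | Bot => GenTree.Node 3 [::]
  | Imp p q => GenTree.Node 4 [:: form_tree p; form_tree q]
  | All1 p => GenTree.Node 5 [:: form_tree p]
  | All2 p => GenTree.Node 6 [:: form_tree p]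
  end.

Lemma tm_tree_inj : injective tm_tree.
Proof.
by elim=> [x|||t IHt u IHu|t IHt u IHu] [y|||t' u'|t' u'] //= [] => [->|/IHt ->
  /IHu ->|/IHt -> /IHu ->].
Qed.

Lemma form_tree_inj : injective form_tree.
Proof.
elim=> [t u|t u|t X||p IHp q IHq|p IH|p IH] [t' u'|t' u'|t' X'||p' q'|p'|p']
  //= [].
- by move=> /tm_tree_inj -> /tm_tree_inj ->.
- by move=> /tm_tree_inj -> /tm_tree_inj ->.
- by move=> /tm_tree_inj -> ->.
- by move=> /IHp -> /IHq ->.
- by move=> /IH ->.
- by move=> /IH ->.
Qed.

Lemma form_enum : exists h : nat -> form, forall p, exists n, h n = p.
Proof.
have H n : exists p, forall q, pickle (form_tree q) = n -> q = p.
  case: (pselect (exists p, pickle (form_tree p) = n)) => [[p <-]|no].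
    exists p => q /(pcan_inj (@pickleK _)); exact: form_tree_inj.
  by exists Bot => q qn; case: no; exists q.
exists (fun n => sval (cid (H n))) => p; exists (pickle (form_tree p)).
by rewrite -(svalP (cid (H _)) p).
Qed.

(** Stands in for a notion of free variable, in the form needed for renaming: indices from [n] on
    have no influence on a substitution. *)
Lemma tm_bound t : exists n, forall s s',
  (forall x, x < n -> s x = s' x) -> tsubst s t = tsubst s' t.
Proof.
elim: t => [x|||t [n IHt] u [m IHu]|t [n IHt] u [m IHu]] /=;
  try by exists 0.
- by exists x.+1 => s s' H; apply: H.
- exists (maxn n m) => s s' H; rewrite (IHt s s') ?(IHu s s') // => x xn;
    by apply: H; rewrite leq_max xn ?orbT.
- exists (maxn n m) => s s' H; rewrite (IHt s s') ?(IHu s s') // => x xn;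
    by apply: H; rewrite leq_max xn ?orbT.
Qed.

Lemma form_bound p : exists n, forall s s' r r',
  (forall x, x < n -> s x = s' x) -> (forall X, X < n -> r X = r' X) ->
  fsubst s r p = fsubst s' r' p.
Proof.
elim: p => [t u|t u|t X||p [n IHp] q [m IHq]|p [n IH]|p [n IH]] /=.
- have [n Hn] := tm_bound t; have [m Hm] := tm_bound u.
  exists (maxn n m) => s s' r r' H _; rewrite (Hn s s') ?(Hm s s') // => x xn;
    by apply: H; rewrite leq_max xn ?orbT.
- have [n Hn] := tm_bound t; have [m Hm] := tm_bound u.
  exists (maxn n m) => s s' r r' H _; rewrite (Hn s s') ?(Hm s s') // => x xn;
    by apply: H; rewrite leq_max xn ?orbT.
- have [n Hn] := tm_bound t; exists (maxn n X.+1) => s s' r r' H H'.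
  rewrite (Hn s s') ?H' ?leq_max ?leqnn ?orbT // => x xn.
  by apply: H; rewrite leq_max xn.
- by exists 0.
- exists (maxn n m) => s s' r r' H H'.
  rewrite (IHp s s' r r') ?(IHq s s' r r') // => x xn;
    by [apply: H; rewrite leq_max xn ?orbT|apply: H'; rewrite leq_max xn ?orbT].
- exists n => s s' r r' H H'; congr All1; apply: IH => // -[|x] //= xn.
  by rewrite H // ltnW.
- exists n => s s' r r' H H'; congr All2; apply: IH => // -[|x] //= xn.
  by rewrite H' // ltnW.
Qed.

Lemma seq_bound (G : seq form) : exists n, forall p, List.In p G ->
  forall s s' r r',
  (forall x, x < n -> s x = s' x) -> (forall X, X < n -> r X = r' X) ->
  fsubst s r p = fsubst s' r' p.
Proof.
elim: G => [|p G [n IH]]; first by exists 0.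
have [m Hm] := form_bound p; exists (maxn n m) => q [<-|qG] s s' r r' H H'.
- apply: Hm => x xn;
    by [apply: H; rewrite leq_max xn ?orbT|apply: H'; rewrite leq_max xn ?orbT].
- apply: IH => // x xn;
    by [apply: H; rewrite leq_max xn ?orbT|apply: H'; rewrite leq_max xn ?orbT].
Qed.

Lemma eq_In_map (A B : Type) (f g : A -> B) (s : seq A) :
  (forall x, List.In x s -> f x = g x) -> map f s = map g s.
Proof.
elim: s => //= a s IH H; rewrite H; last by left.
by rewrite IH // => x xs; apply: H; right.
Qed.

Section Completeness.
Variable T : form -> Prop.
Hypothesis Tsubst : forall s r p, T p -> T (fsubst s r p).

(* A variable not free in [G] and [p] can be renamed to the bound one, all
   others being shifted. *)
Lemma fresh_all1 G p :
  exists x, prv T G (inst1 (Var x) p) -> prv T G (All1 p).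
Proof.
have [n Hn] := seq_bound (p :: G); exists n => H; apply: prv_all1I.
pose s x := if x == n then Var 0 else Var x.+1.
have sE x : x < n -> s x = Var x.+1 by rewrite /s; case: eqP => // ->; rewrite
  ltnn.
have := prv_subst Tsubst s id H; congr (prv _ _ _).
  by apply: eq_In_map => q qG; apply: Hn; [right|move=> x /sE|].
rewrite fsubst_comp -[RHS]fsubst_id; apply: Hn => //; first by left.
by case=> [_|x xn] /=; [rewrite /s eqxx|rewrite sE // ltnW].
Qed.

Lemma fresh_all2 G p :
  exists X, prv T G (inst2 X p) -> prv T G (All2 p).
Proof.
have [n Hn] := seq_bound (p :: G); exists n => H; apply: prv_all2I.
pose r x := if x == n then 0 else x.+1.
have rE x : x < n -> r x = x.+1 by rewrite /r; case: eqP => // ->; rewrite ltnn.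
have := prv_subst Tsubst Var r H; congr (prv _ _ _).
  by apply: eq_In_map => q qG; apply: Hn; [right| |move=> x /rE].
rewrite fsubst_comp -[RHS]fsubst_id; apply: Hn => //; first by left.
by case=> [_|x xn] /=; [rewrite /r eqxx|rewrite rE // ltnW].
Qed.

Definition consistent G := ~ prv T G Bot.

(** If [q] is refutable from [G], nothing is added. Otherwise [q] is added and, when it is a negated
    universal formula, a counterexample too. As [G] is finite, a fresh variable can play the role of
    the Henkin constant. *)
Lemma henkin_step G q : consistent G -> exists G', [/\ consistent G',
  forall x, List.In x G -> List.In x G',
  List.In q G' \/ prv T G' (Neg q),
  forall p, q = Neg (All1 p) ->
    prv T G' (All1 p) \/ exists x, List.In (Neg (inst1 (Var x) p)) G' &
  forall p, q = Neg (All2 p) ->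
    prv T G' (All2 p) \/ exists X, List.In (Neg (inst2 X p)) G'].
Proof.
move=> cG; case: (pselect (prv T (q :: G) Bot)) => [qb|cqG].
  exists G; split=> //; first by right; apply: prv_impI.
    by move=> p qE; left; apply: prv_raa; rewrite -qE.
  by move=> p qE; left; apply: prv_raa; rewrite -qE.
case: (pselect (exists p, q = Neg (All1 p))) => [[p qE]|no1].
  have [x Hx] := fresh_all1 (q :: G) p.
  exists (Neg (inst1 (Var x) p) :: q :: G); split=> /=.
  - move=> H; apply: cqG; apply: (prv_impE (p := All1 p)).
      by apply: prv_hyp; left.
    by apply: Hx; apply: prv_raa.
  - by move=> y yG; right; right.
  - by left; right; left.
  - by move=> p'; rewrite qE => -[<-]; right; exists x; left.
  - by move=> p'; rewrite qE.
case: (pselect (exists p, q = Neg (All2 p))) => [[p qE]|no2].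
  have [x Hx] := fresh_all2 (q :: G) p.
  exists (Neg (inst2 x p) :: q :: G); split=> /=.
  - move=> H; apply: cqG; apply: (prv_impE (p := All2 p)).
      by apply: prv_hyp; left.
    by apply: Hx; apply: prv_raa.
  - by move=> y yG; right; right.
  - by left; right; left.
  - by move=> p'; rewrite qE.
  - by move=> p'; rewrite qE => -[<-]; right; exists x; left.
exists (q :: G); split=> //=; try by [right|left; left|move=> p qE; case: no1;
  exists p|move=> p qE; case: no2; exists p].
Qed.

(* The deductive closure of a maximal consistent Henkin extension of [G0]. *)
Lemma henkin_extension G0 : consistent G0 -> exists D : form -> Prop,
  [/\ forall p, prv T G0 p -> D p, forall s r p, T p -> D (fsubst s r p),
      forall t, D (Eq t t) & forall t u p, D (Eq t u) -> D (inst1 t p) -> D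
        (inst1 u p)] /\
  [/\ ~ D Bot, forall p q, D (Imp p q) <-> (D p -> D q),
      forall p, D (All1 p) <-> forall t, D (inst1 t p) &
      forall p, D (All2 p) <-> forall X, D (inst2 X p)].
Proof.
move=> cG0; have [h hP] := form_enum.
pose step n (G : {G | consistent G}) : {G | consistent G} :=
  let: exist G' H := cid (henkin_step (h n) (svalP G)) in
  exist _ G' (let: And5 c _ _ _ _ := H in c).
pose Gs := fix Gs n := if n is m.+1 then step m (Gs m) else exist _ G0 cG0.
pose G n := sval (Gs n).
have GS n : [/\ forall x, List.In x (G n) -> List.In x (G n.+1),
  List.In (h n) (G n.+1) \/ prv T (G n.+1) (Neg (h n)),
  forall p, h n = Neg (All1 p) ->
    prv T (G n.+1) (All1 p) \/ exists x, List.In (Neg (inst1 (Var x) p)) (G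
      n.+1) &
  forall p, h n = Neg (All2 p) ->
    prv T (G n.+1) (All2 p) \/ exists X, List.In (Neg (inst2 X p)) (G n.+1)].
  by rewrite /G /= /step; case: cid => /= G' [].
have cG n : ~ prv T (G n) Bot := svalP (Gs n).
have Gle n m : n <= m -> forall x, List.In x (G n) -> List.In x (G m).
  move=> /subnK <-; elim: (m - n) => // k IH x /IH; rewrite addSn.
  by have [H _ _ _] := GS (k + n); apply: H.
pose D p := exists n, prv T (G n) p.
have Dle n m p : n <= m -> prv T (G n) p -> prv T (G m) p.
  by move=> nm; apply: prv_weak; apply: Gle.
have D2 (P : Prop) p q : D p -> D q ->
    (forall n, prv T (G n) p -> prv T (G n) q -> P) -> P.
  move=> [n Hn] [m Hm] H; apply: (H (maxn n m)).
    exact: Dle (leq_maxl _ _) Hn.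
  exact: Dle (leq_maxr _ _) Hm.
have Dmp p q : D (Imp p q) -> D p -> D q.
  move=> H1 H2; apply: (D2 _ _ _ H1 H2) => n K1 K2.
  by exists n; apply: prv_impE K1 K2.
have Dbot : ~ D Bot by move=> [n /cG].
have Dem p : D p \/ D (Neg p).
  have [n <-] := hP p; have [_ [H|H] _ _] := GS n; last by right; exists n.+1.
  by left; exists n.+1; apply: prv_hyp.
exists D; split; split=> //.
- by move=> p Hp; exists 0.
- by move=> s r p /Tsubst Tp; exists 0; apply: prv_ax.
- by move=> t; exists 0; apply: prv_eqI.
- move=> t u p H1 H2; apply: (D2 _ _ _ H1 H2) => n K1 K2.
  by exists n; apply: prv_eqE K1 K2.
- move=> p q; split=> [/Dmp//|H]; case: (Dem p) => [/H[n Hn]|[n Hn]].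
    by exists n; apply/prv_impI/prv_cons.
  exists n; apply/prv_impI/prv_efq/(@prv_impE _ _ p)/prv_hyp0.
  exact: prv_cons.
- move=> p; split=> [[n Hn] t|H]; first by exists n; apply: prv_all1E.
  have [n hn] := hP (Neg (All1 p)); have [_ _ K _] := GS n.
  case: (K p hn) => [?|[x Hx]]; first by exists n.+1.
  case: Dbot; apply: Dmp (H (Var x)); exists n.+1; exact: prv_hyp.
- move=> p; split=> [[n Hn] t|H]; first by exists n; apply: prv_all2E.
  have [n hn] := hP (Neg (All2 p)); have [_ _ _ K] := GS n.
  case: (K p hn) => [?|[x Hx]]; first by exists n.+1.
  case: Dbot; apply: Dmp (H x); exists n.+1; exact: prv_hyp.
Qed.

Lemma completeness p :
  (forall M, model T M -> forall (e : nat -> dom M) f, sat e f p) -> prv T [::]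
    p.
Proof.
move=> Hp; apply: contrapT => np.
have cN : consistent [:: Neg p] by move=> H; apply/np/prv_raa.
have [D [[D0 DT Deq DeqE] [DB DI DA1 DA2]]] := henkin_extension cN.
have shK t u : tsubst (scons u Var) (tshift t) = t.
  by rewrite /tshift tsubst_comp tsubst_id.
(* Equality comes with Leibniz's rule only; each congruence is an instance of it in which [Var 0]
   marks the replaced occurrence. *)
have Dsym t u : D (Eq t u) -> D (Eq u t).
  move=> H; move: (DeqE t u (Eq (Var 0) (tshift t)) H); rewrite /inst1 /=.
  by rewrite !shK; apply.
have Dtr t u v : D (Eq t u) -> D (Eq u v) -> D (Eq t v).
  move=> H1 H2; move: (DeqE u v (Eq (tshift t) (Var 0)) H2); rewrite /inst1 /=.
  by rewrite !shK; apply.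
pose R t u := D (Eq t u); pose cl := qcl R.
have clE t u : cl t = cl u <-> D (Eq t u).
  exact: (@qclE _ R Deq Dsym Dtr).
have clK (d : quot R) : cl (qrep d) = d by apply: qrepK.
have clD t : D (Eq (qrep (cl t)) t) by apply/clE; rewrite clK.
have Dplus t t' u u' : D (Eq t t') -> D (Eq u u') -> D (Eq (Plus t u) (Plus t'
  u')).
  move=> H1 H2.
  move: (DeqE _ _ (Eq (tshift (Plus t u)) (Plus (Var 0) (tshift u))) H1).
  rewrite /inst1 /= !shK => /(_ (Deq _)) K.
  move: (DeqE _ _ (Eq (tshift (Plus t u)) (Plus (tshift t') (Var 0))) H2).
  by rewrite /inst1 /= !shK; apply.
have Dmult t t' u u' : D (Eq t t') -> D (Eq u u') -> D (Eq (Mult t u) (Mult t'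
  u')).
  move=> H1 H2.
  move: (DeqE _ _ (Eq (tshift (Mult t u)) (Mult (Var 0) (tshift u))) H1).
  rewrite /inst1 /= !shK => /(_ (Deq _)) K.
  move: (DeqE _ _ (Eq (tshift (Mult t u)) (Mult (tshift t') (Var 0))) H2).
  by rewrite /inst1 /= !shK; apply.
have Dlt t t' u u' : D (Eq t t') -> D (Eq u u') -> D (Lt t u) -> D (Lt t' u').
  move=> H1 H2 H3.
  move: (DeqE _ _ (Lt (Var 0) (tshift u)) H1); rewrite /inst1 /= !shK => /(_
    H3).
  by move: (DeqE _ _ (Lt (tshift t') (Var 0)) H2); rewrite /inst1 /= !shK.
have Din t t' X : D (Eq t t') -> D (In t X) -> D (In t' X).
  by move=> H; move: (DeqE _ _ (In (Var 0) X) H); rewrite /inst1.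
(* Set variables denote themselves: the language has no equality between sets, so only terms are
   divided by an equivalence. *)
pose M := {| dom := quot R; sets := nat; dzero := cl Zero; dunit := cl One;
  dadd a b := cl (Plus (qrep a) (qrep b));
  dmul a b := cl (Mult (qrep a) (qrep b));
  dlt a b := D (Lt (qrep a) (qrep b)); dmem a X := D (In (qrep a) X) |}.
have tevalE s t : @teval M (fun x => cl (s x)) t = cl (tsubst s t).
  elim: t => //= t -> u ->; apply/clE; by [apply: Dplus|apply: Dmult].
(* Truth lemma, stated with a substitution in place of an environment so that the quantifier cases
   can extend it by any term or set variable. *)
have satE q s r : @sat M (fun x => cl (s x)) r q <-> D (fsubst s r q).
  elim: q s r => /= [t u|t u|t X||q IHq q' IHq'|q IH|q IH] s r.
  - by rewrite !tevalE clE.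
  - by rewrite !tevalE; split; apply: Dlt => //; apply: Dsym.
  - by rewrite !tevalE; split; apply: Din => //; apply: Dsym.
  - by split.
  - by rewrite DI -IHq -IHq'.
  - have E t : inst1 t (fsubst (up1 s) r q) = fsubst (scons t s) r q.
      rewrite /inst1 fsubst_comp; congr fsubst; apply/funext => -[|x] //=.
    have E' t : scons (cl t) (fun x => cl (s x)) = fun x => cl (scons t s x).
      by apply/funext => -[].
    rewrite DA1; split=> [H t|H a]; first by rewrite E -IH -E'.
    by rewrite -(clK a) E'; apply/IH; rewrite -E.
  - have E X : inst2 X (fsubst s (up2 r) q) = fsubst s (scons X r) q.
      rewrite /inst2 fsubst_comp; congr fsubst; last by apply/funext => -[].
      by apply/funext => x; rewrite tsubst_id.
    by rewrite DA2; split=> H X; [rewrite E -IH|apply/IH; rewrite -E].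
have MT : model T M.
  move=> q Tq e f; rewrite (_ : e = fun x => cl (qrep (e x))); last first.
    by apply/funext => x; rewrite clK.
  by apply/satE/DT.
have := Hp M MT (fun x => cl (Var x)) id; rewrite satE fsubst_id => Dp.
by apply: DB; apply: (DI p Bot).1 Dp; apply: D0; apply: prv_hyp0.
Qed.
End Completeness.

(** * Models of RCA0 *)
Lemma up1_tshift s t : tsubst (up1 s) (tshift t) = tshift (tsubst s t).
Proof. by rewrite /tshift !tsubst_comp. Qed.

Lemma Delta00_subst s r p : Delta00 p -> Delta00 (fsubst s r p).
Proof.
move=> H; elim: H s r => {p} /=.
- by constructor.
- by constructor.
- by constructor.
- by constructor.
- move=> p q _ IHp _ IHq s r; constructor; [exact: IHp|exact: IHq].
- move=> t p _ IH s r; rewrite up1_tshift; constructor; exact: IH.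
Qed.

Lemma Sigma01_subst s r p : Sigma01 p -> Sigma01 (fsubst s r p).
Proof. by case=> q dq ->; exists (fsubst (up1 s) r q) => //; apply:
  Delta00_subst. Qed.

Lemma Pi01_subst s r p : Pi01 p -> Pi01 (fsubst s r p).
Proof. by case=> q dq ->; exists (fsubst (up1 s) r q) => //; apply:
  Delta00_subst. Qed.

(** The basic axioms are closed, and a substitution acts on an instance of a scheme by acting on the
    formula in it, whose class it preserves. *)
Lemma RCA0_subst s r p : RCA0 p -> RCA0 (fsubst s r p).
Proof.
case=> {p} [p Hp|p Sp|p q Sp Pq].
- suff -> : fsubst s r (p 0 0) = p 0 0 by apply: RCA0_basic.
  by move: Hp => /=; do ![case=> [<- //|]].
- suff -> : fsubst s r (induction_axiom p) =
      induction_axiom (fsubst (up1 s) r p).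
    by apply/RCA0_induction/Sigma01_subst.
  rewrite /induction_axiom /= fsubst_inst1 /= !fsubst_comp.
  congr (Imp (And _ (All1 (Imp _ _))) _).
  by congr fsubst; apply/funext => -[|x] //=; rewrite /tshift !tsubst_comp.
- suff -> : fsubst s r (comprehension_axiom p q) =
      comprehension_axiom (fsubst (up1 s) r p) (fsubst (up1 s) r q).
    apply: RCA0_comprehension; [exact: Sigma01_subst|exact: Pi01_subst].
  by rewrite /comprehension_axiom /= !fsubst_shift2.
Qed.

(** * Reading formulas in a structure and recognizing bounded ones *)

Fixpoint fsize (p : form) : nat :=
  match p with
  | Imp p q => (fsize p + fsize q).+1
  | All1 p => (fsize p).+1
  | All2 p => (fsize p).+1
  | _ => 0
  end.

(* Satisfaction with the encodings of conjunctions and of existential (also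
   bounded) quantifiers read as the genuine connectives, so that a concrete
   formula is convertible to its intended meaning. *)
Fixpoint holds (M : structure) (e : nat -> dom M) (f : nat -> sets M) (p : form)
    : Prop :=
  match p with
  | Eq t u => teval e t = teval e u
  | Lt t u => dlt (teval e t) (teval e u)
  | In t X => dmem (teval e t) (f X)
  | Bot => False
  | Imp p q =>
      match q with
      | Bot =>
          match p with
          | Imp a (Imp b Bot) => holds e f a /\ holds e f b
          | All1 (Imp a Bot) => exists x, holds (scons x e) f a
          | All1 (Imp a (Imp b Bot)) =>
              exists x, holds (scons x e) f a /\ holds (scons x e) f b
          | All2 (Imp a Bot) => exists X, holds e (scons X f) a
          | _ => ~ holds e f p
          end
      | _ => holds e f p -> holds e f q
      end
  | All1 p => forall a, holds (scons a e) f p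
  | All2 p => forall X, holds e (scons X f) p
  end.

(** Induction on [fsize] reaches the subformulas that the nested patterns of [holds] expose several
    constructors deep. In the special patterns the two readings agree by classical logic. *)
Lemma holdsE M (e : nat -> dom M) f p : holds e f p <-> sat e f p.
Proof.
have [n] := ubnP (fsize p); elim: n p e f => // n IH p e f.
have IHi a b : (fsize a + fsize b < n) ->
    (holds e f a -> holds e f b) <-> (sat e f a -> sat e f b).
  move=> ab; have ha : holds e f a <-> sat e f a.
    by apply: IH; apply: leq_ltn_trans (leq_addr _ _) ab.
  have hb : holds e f b <-> sat e f b.
    by apply: IH; apply: leq_ltn_trans (leq_addl _ _) ab.
  by rewrite ha hb.
case: p => [t u|t u|t X||p q|p|p]; try by []; rewrite /= ltnS.
- case: q => [t' u'|t' u'|t' X'||p' q'|p'|p']; try by move=> /IHi.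
  case: p => [t u|t u|t X||p q|p|p]; try by move=> /IHi.
  + case: q => [t u|t u|t X||q r|q|q]; try by move=> /IHi.
    case: r => [t u|t u|t X||r1 r2|r|r]; try by move=> /IHi.
    rewrite /= !addn0 addnS => /ltnW sz.
    have hp : holds e f p <-> sat e f p.
      by apply: IH; apply: leq_ltn_trans (leq_addr _ _) (ltnW sz).
    have hq : holds e f q <-> sat e f q.
      by apply: IH; apply: leq_ltn_trans (leq_addl _ _) (ltnW sz).
    rewrite hp hq; split=> [[a b]|H]; first by apply.
    by apply: contrapT => K; apply: H => a b; apply: K.
  + case: p => [t u|t u|t X||p q|p|p]; try by move=> /IHi.
    case: q => [t u|t u|t X||q r|q|q]; try by move=> /IHi.
      rewrite /= !addn0 => /ltnW /ltnW sz.
      have hp a : holds (scons a e) f p <-> sat (scons a e) f p by apply: IH.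
      split=> [[a /hp H]|H]; first by move/(_ a).
      by apply: contrapT => K; apply: H => a /hp Ha; apply: K; exists a.
    case: r => [t u|t u|t X||r1 r2|r|r]; try by move=> /IHi.
    rewrite /= !addn0 addnS => /ltnW/ltnW/ltnW sz.
    have hp a : holds (scons a e) f p <-> sat (scons a e) f p.
      by apply: IH; apply: leq_ltn_trans (leq_addr _ _) sz.
    have hq a : holds (scons a e) f q <-> sat (scons a e) f q.
      by apply: IH; apply: leq_ltn_trans (leq_addl _ _) sz.
    split=> [[a [/hp H /hq H']]|H]; first by move/(_ a H).
    by apply: contrapT => K; apply: H => a /hp Ha /hq Ha'; apply: K; exists a.
  + case: p => [t u|t u|t X||p q|p|p]; try by move=> /IHi.
    case: q => [t u|t u|t X||q r|q|q]; try by move=> /IHi.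
    rewrite /= !addn0 => /ltnW /ltnW sz.
    have hp a : holds e (scons a f) p <-> sat e (scons a f) p by apply: IH.
    split=> [[a /hp H]|H]; first by move/(_ a).
    by apply: contrapT => K; apply: H => a /hp Ha; apply: K; exists a.
- by move=> /= sz; split=> H a; apply/IH.
- by move=> /= sz; split=> H a; apply/IH.
Qed.

Fixpoint nofree0 (t : tm) : bool :=
  match t with
  | Var x => 0 < x
  | Plus t u | Mult t u => nofree0 t && nofree0 u
  | _ => true
  end.

(** A boolean test, so that a concrete formula is seen to be bounded by [isT]. The bound of a
    quantifier has to be a shifted term, which [nofree0] ensures by excluding [Var 0]. *)
Fixpoint isDelta00 (p : form) : bool :=
  match p with
  | Imp p q => isDelta00 p && isDelta00 q
  | All1 (Imp (Lt (Var 0) t) p) => nofree0 t && isDelta00 p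
  | All1 _ | All2 _ => false
  | _ => true
  end.

Lemma nofree0P t : nofree0 t -> exists u, t = tshift u.
Proof.
elim: t => [[|x]|||t IHt u IHu|t IHt u IHu] //=.
- by exists (Var x).
- by exists Zero.
- by exists One.
- by move=> /andP[/IHt[t' ->] /IHu[u' ->]]; exists (Plus t' u').
- by move=> /andP[/IHt[t' ->] /IHu[u' ->]]; exists (Mult t' u').
Qed.

Lemma isDelta00P p : isDelta00 p -> Delta00 p.
Proof.
have [n] := ubnP (fsize p); elim: n p => // n IH [t u|t u|t X||p q|p|p] //=;
  rewrite ?ltnS; try by constructor.
- move=> sz /andP[Hp Hq]; constructor; apply: IH => //.
    exact: leq_ltn_trans (leq_addr _ _) sz.
  exact: leq_ltn_trans (leq_addl _ _) sz.
- case: p => // -[] // -[] // -[] //= t p; rewrite add0n => /ltnW sz.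
  by move=> /andP[/nofree0P[u ->] Hp]; constructor; apply: IH.
Qed.

Lemma satAnd M (e : nat -> dom M) f p q :
  sat e f (And p q) <-> sat e f p /\ sat e f q.
Proof.
split=> /= [H|[a b]]; last by apply.
by apply: contrapT => K; apply: H => a b; apply: K.
Qed.

Lemma satEx1 M (e : nat -> dom M) f p :
  sat e f (Ex1 p) <-> exists a, sat (scons a e) f p.
Proof.
split=> /= [H|[a Ha]]; last by move/(_ a).
by apply: contrapT => K; apply: H => a Ha; apply: K; exists a.
Qed.

(** * Induction and comprehension in a model *)

Section Schemes.
Variable M : structure.
Hypothesis MP : model RCA0 M.
Implicit Types (e : nat -> dom M) (f : nat -> sets M).

Lemma sat_sigma_ind e f p : Sigma01 p -> sat (scons dzero e) f p ->
  (forall n, sat (scons n e) f p -> sat (scons (dadd n dunit) e) f p) ->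
  forall n, sat (scons n e) f p.
Proof.
move=> Sp H0 HS; have := MP (RCA0_induction Sp) e f.
rewrite /induction_axiom; set a := And _ _ => H; apply: (H : sat e f a -> _).
apply/satAnd; split.
  by rewrite /inst1 sat_subst; move: H0; congr sat; apply/funext => -[].
move=> m; rewrite -[sat _ _ _]/(sat _ f p -> sat _ f (fsubst _ _ p)) sat_subst.
by move=> /HS; congr sat; apply/funext => -[].
Qed.

Lemma holds_sigma_ind e f q : isDelta00 q ->
  holds (scons dzero e) f (Ex1 q) ->
  (forall n, holds (scons n e) f (Ex1 q) ->
     holds (scons (dadd n dunit) e) f (Ex1 q)) ->
  forall n, holds (scons n e) f (Ex1 q).
Proof.
move=> /isDelta00P dq /holdsE H0 HS n; apply/holdsE; apply: sat_sigma_ind => //.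
  by exists q.
by move=> m /holdsE/HS/holdsE.
Qed.

(** [Sigma01] literally demands a leading quantifier; bounded formulas enter the schemes through
    this vacuous one. *)
Definition dummy_ex p := Ex1 (shift1 p).

Lemma sat_dummy_ex e f p : sat e f (dummy_ex p) <-> sat e f p.
Proof.
rewrite satEx1; split=> [[a]|H]; first by rewrite /shift1 sat_subst.
by exists dzero; rewrite /shift1 sat_subst.
Qed.

Lemma holds_delta_ind e f p : isDelta00 p ->
  holds (scons dzero e) f p ->
  (forall n, holds (scons n e) f p -> holds (scons (dadd n dunit) e) f p) ->
  forall n, holds (scons n e) f p.
Proof.
move=> /isDelta00P dp /holdsE H0 HS n; apply/holdsE/sat_dummy_ex.
apply: sat_sigma_ind; last by move=> m
  /sat_dummy_ex/holdsE/HS/holdsE/sat_dummy_ex.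
  by exists (shift1 p) => //; apply: Delta00_subst.
exact/sat_dummy_ex.
Qed.

(** The two sides of the comprehension axiom are [p] under a vacuous existential and under a vacuous
    universal quantifier. *)
Lemma holds_delta_comp e f p : isDelta00 p ->
  exists X, forall n, dmem n X <-> holds (scons n e) f p.
Proof.
move=> /isDelta00P dp.
have dq := Delta00_subst (fun x => Var x.+1) id dp.
have Sq : Sigma01 (dummy_ex p) by exists (shift1 p).
have Pq : Pi01 (All1 (shift1 p)) by exists (shift1 p).
have := MP (RCA0_comprehension Sq Pq) e f.
rewrite /comprehension_axiom; set a := All1 (Iff _ _); set b := Ex2 _.
have /[swap]/[apply] : sat e f a.
  move=> m; apply/satAnd; split; first last.
    move=> H; apply/sat_dummy_ex.
    by move: (H dzero : sat (scons dzero _) f (shift1 p)); rewrite /shift1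
      sat_subst.
  move=> /sat_dummy_ex H x.
  suff : sat (scons x (scons m e)) f (shift1 p) by [].
  by rewrite /shift1 sat_subst.
move=> H; apply: contrapT => K; apply: H => X HX; apply: K; exists X => n.
have [H1 H2] := (satAnd _ _ _ _).1 
  (HX n : sat (scons n e) (scons X f) (Iff (In (Var 0) 0) (shift2 (dummy_ex
    p)))).
rewrite holdsE -sat_dummy_ex.
have E : sat (scons n e) (scons X f) (shift2 (dummy_ex p)) <->
    sat (scons n e) f (dummy_ex p) by rewrite /shift2 sat_subst.
by split=> [/H1/E|/E/H2].
Qed.
End Schemes.

(* The formulas of the statement read in a structure: each name is that of the
   formula it interprets. *)
Module Sem.
Section Sem.
Variable M : structure.
Local Notation D := (dom M).
Local Notation S := (sets M).
Local Notation "x + y" := (dadd x y).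
Local Notation "x * y" := (dmul x y).
Local Notation "x < y" := (dlt x y).
Local Notation "0" := (@dzero M).
Local Notation "1" := (@dunit M).
Local Notation "2" := (1 + 1).
Local Notation "4" := (2 + 2).
Local Notation "x ∈ X" := (dmem x X) (at level 70).

(** The disjunction of [fLe] abbreviates an implication, which [holds] leaves as it is; this shape
    keeps the two convertible. *)
Definition Le (x y : D) := ~ x < y -> x = y.
Local Notation "x <= y" := (Le x y).

Definition npair (x y : D) : D := (x + y) * (x + y) + x.
Local Notation "⟨ x , y , .. , z ⟩" := (npair .. (npair x y) .. z) (at level 0).

Definition IsFun (F : S) (Dom Cod : D -> Prop) : Prop :=
  (forall z, z ∈ F -> exists x y, z = ⟨x, y⟩ /\ Dom x /\ Cod y)
  /\ (forall x, Dom x -> exists y, ⟨x, y⟩ ∈ F)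
  /\ (forall x y y', ⟨x, y⟩ ∈ F -> ⟨x, y'⟩ ∈ F -> y = y').

Definition IsNat (x : D) := ~ False.

Definition Pow2 (k e : D) : Prop :=
  exists E, IsFun E IsNat IsNat /\ ⟨0, 1⟩ ∈ E
    /\ (forall i j, ⟨i, j⟩ ∈ E -> ⟨i + 1, 2 * j⟩ ∈ E)
    /\ ⟨k, e⟩ ∈ E.

Record rat := Rat { rpos : D; rneg : D; rden : D }.

Definition rcode (u : rat) : D := ⟨rpos u, rneg u, rden u⟩.
Definition ratP (u : rat) : Prop := 0 < rden u.
Definition rat_posP (u : rat) : Prop := 0 < rden u /\ rneg u < rpos u.

Definition rat_add (u v : rat) : rat :=
  Rat (rpos u * rden v + rpos v * rden u)
      (rneg u * rden v + rneg v * rden u)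
      (rden u * rden v).
Definition rat_le (u v : rat) : Prop :=
  rpos u * rden v + rneg v * rden u <= rpos v * rden u + rneg u * rden v.
Definition rat_lt (u v : rat) : Prop :=
  rpos u * rden v + rneg v * rden u < rpos v * rden u + rneg u * rden v.

Definition rat_frac (m p : D) : rat := Rat m 0 p.

Definition ExQ (F : rat -> Prop) : Prop :=
  exists m n p, ratP (Rat m n p) /\ F (Rat m n p).
Definition ExQpos (F : rat -> Prop) : Prop :=
  exists m n p, rat_posP (Rat m n p) /\ F (Rat m n p).
Definition AllQpos (F : rat -> Prop) : Prop :=
  forall m n p, rat_posP (Rat m n p) -> F (Rat m n p).

Definition IsQ (x : D) : Prop := ExQ (fun u => x = rcode u).
Definition IsQpos (x : D) : Prop := ExQpos (fun u => x = rcode u).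

Definition real := D -> (rat -> Prop) -> Prop.

Definition real_of_set (X : S) : real :=
  fun k F => ExQ (fun u => ⟨k, rcode u⟩ ∈ X /\ F u).
Definition real_of_rat (u : rat) : real := fun k F => F u.
Definition real0 : real := real_of_rat (rat_frac 0 1).
Definition real_add (x y : real) : real :=
  fun k F => x (k + 1) (fun u => y (k + 1) (fun v => F (rat_add u v))).

Definition RapidlyConverging (x : real) : Prop :=
  forall k i, exists e, Pow2 k e /\
    x k (fun u => x (k + i) (fun v =>
      rat_le u (rat_add v (rat_frac 1 e)) /\
      rat_le v (rat_add u (rat_frac 1 e)))).

Definition IsReal (X : S) : Prop :=
  IsFun X IsNat IsQ /\ RapidlyConverging (real_of_set X).

Definition real_le (x y : real) : Prop :=
  forall k, exists e, Pow2 k e /\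
    x k (fun u => y k (fun v => rat_le u (rat_add v (rat_frac 2 e)))).
(** This is how [holds] reads the negation of [real_le y x]: the outer universal quantifier turns
    into an existential one. *)
Definition real_lt (x y : real) : Prop :=
  exists k, forall e, ~ (Pow2 k e /\
    y k (fun u => x k (fun v => rat_le u (rat_add v (rat_frac 2 e))))).
Definition real_eq (x y : real) : Prop := real_le x y /\ real_le y x.

Definition AllRpos (F : real -> Prop) : Prop :=
  forall X, IsReal X -> real_lt real0 (real_of_set X) -> F (real_of_set X).
Definition ExRpos (F : real -> Prop) : Prop :=
  exists X, IsReal X /\ real_lt real0 (real_of_set X) /\ F (real_of_set X).

Definition mdist (d : S) (a b : D) : real :=
  fun k F => ExQ (fun u => ⟨⟨a, b⟩, k, rcode u⟩ ∈ d /\ F u).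

Definition IsSpace (A d : S) : Prop :=
  IsFun d (fun z => exists a b k, z = ⟨a, b, k⟩ /\ a ∈ A /\ b ∈ A) IsQ
  /\ (forall a b, a ∈ A -> b ∈ A -> RapidlyConverging (mdist d a b))
  /\ (forall a, a ∈ A -> real_eq (mdist d a a) real0)
  /\ (forall a b, a ∈ A -> b ∈ A ->
        real_eq (mdist d a b) (mdist d b a) /\ real_le real0 (mdist d a b))
  /\ (forall a b c, a ∈ A -> b ∈ A -> c ∈ A ->
        real_le (mdist d a b) (real_add (mdist d a c) (mdist d c b))).

Definition IsPoint (A d X : S) : Prop :=
  IsFun X IsNat (fun a => a ∈ A)
  /\ (forall n a b, ⟨n, a⟩ ∈ X -> ⟨n + 1, b⟩ ∈ X ->
        exists e, Pow2 n e /\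
          real_lt (mdist d a b) (real_of_rat (rat_frac 1 e))).

Definition point := D -> (D -> Prop) -> Prop.

Definition point_of_set (X : S) : point :=
  fun k F => exists a, ⟨k, a⟩ ∈ X /\ F a.
Definition point_of_elt (a : D) : point := fun k F => F a.

Definition pdist (d : S) (x y : point) : real :=
  fun k F => x (k + 4) (fun a => y (k + 4) (fun b =>
    mdist d a b (k + 2) F)).

Definition AllPt (A d : S) (F : point -> Prop) : Prop :=
  forall X, IsPoint A d X -> F (point_of_set X).

Definition IsOpenSeq (A U : S) : Prop :=
  IsFun U (fun z => exists n k, z = ⟨n, k⟩)
          (fun z => exists a q, z = ⟨a, q⟩ /\ a ∈ A /\ IsQpos q).

Definition InOpen (d U : S) (n : D) (x : point) : Prop :=
  exists k a, ExQpos (fun q => ⟨⟨n, k⟩, ⟨a, rcode q⟩⟩ ∈ U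
    /\ real_lt (pdist d x (point_of_elt a)) (real_of_rat q)).

Definition IsOpenCover (A d U : S) : Prop :=
  IsOpenSeq A U /\ AllPt A d (fun x => exists n, InOpen d U n x).

Definition Lebesgue (A d : S) : Prop :=
  forall U, IsOpenCover A d U ->
    ExRpos (fun q =>
      AllPt A d (fun x => exists n,
        AllPt A d (fun y => real_lt (pdist d x y) q -> InOpen d U n y))).

Definition CodeRel (P : S) (a : D) (r : rat) (b : D) (s : rat) : Prop :=
  exists n, ⟨n, a, rcode r, b, rcode s⟩ ∈ P.

Definition IsContFun (A d B d' P : S) : Prop :=
  (forall z, z ∈ P -> exists n a r b s, z = ⟨n, a, r, b, s⟩
      /\ a ∈ A /\ IsQpos r /\ b ∈ B /\ IsQpos s)
  /\ (forall a b b', AllQpos (fun r => AllQpos (fun s => AllQpos (fun s' =>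
        CodeRel P a r b s -> CodeRel P a r b' s' ->
        real_lt (mdist d' b b') (real_of_rat (rat_add s s'))))))
  /\ (forall a b b', AllQpos (fun r => AllQpos (fun s => AllQpos (fun s' =>
        b' ∈ B -> CodeRel P a r b s ->
        real_le (real_add (mdist d' b b') (real_of_rat s)) (real_of_rat s') ->
        CodeRel P a r b' s'))))
  /\ (forall a a' b, AllQpos (fun r => AllQpos (fun r' => AllQpos (fun s =>
        a' ∈ A -> CodeRel P a r b s ->
        real_le (real_add (mdist d a a') (real_of_rat r')) (real_of_rat r) ->
        CodeRel P a' r' b s))))
  /\ AllPt A d (fun x => AllQpos (fun q =>
        exists a b, ExQpos (fun r => ExQpos (fun s =>
          CodeRel P a r b s
          /\ real_lt (pdist d x (point_of_elt a)) (real_of_rat r)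
          /\ rat_lt s q)))).

Definition IsValue (d d' P : S) (x y : point) : Prop :=
  forall a b, AllQpos (fun r => AllQpos (fun s =>
    CodeRel P a r b s ->
    real_lt (pdist d x (point_of_elt a)) (real_of_rat r) ->
    real_lt (pdist d' y (point_of_elt b)) (real_of_rat s))).

Definition UnifCont (A d B d' P : S) : Prop :=
  AllRpos (fun eps => ExRpos (fun delta =>
    AllPt A d (fun x => AllPt A d (fun y =>
      AllPt B d' (fun fx => AllPt B d' (fun fy =>
        IsValue d d' P x fx -> IsValue d d' P y fy ->
        real_lt (pdist d x y) delta -> real_lt (pdist d' fx fy) eps)))))).

Definition Atsuji (A d : S) : Prop :=
  forall B d', IsSpace B d' ->
    forall P, IsContFun A d B d' P -> UnifCont A d B d' P.
End Sem.
End Sem.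

Lemma holds_statement M (e : nat -> dom M) f :
  (forall A d : sets M, Sem.IsSpace A d -> Sem.Lebesgue A d -> Sem.Atsuji A d)
    ->
  holds e f ((ALL2 A d, IsSpace A d ⇒ Lebesgue A d ⇒ Atsuji A d)%fm 0%N 0%N).
Proof. exact. Qed.

(** Environments are total; [rset] fills the set variables that are not fixed otherwise. *)
Record rca := Rca {
  rstruct :> structure;
  rmodel : model RCA0 rstruct;
  rset : sets rstruct
}.

Definition nn (M : rca) : Type := dom M.

HB.instance Definition _ (M : rca) := gen_eqMixin (nn M).
HB.instance Definition _ (M : rca) := gen_choiceMixin (nn M).

(** * Semiring and order laws in a model *)

Section Arithmetic.
Variable M : rca.
Local Notation D := (nn M).
Local Notation "x + y" := (@dadd M x y).
Local Notation "x * y" := (@dmul M x y).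
Local Notation "x < y" := (@dlt M x y).
Local Notation "0" := (@dzero M).
Local Notation "1" := (@dunit M).
Implicit Types a b c x y z n : D.

Definition env0 : nat -> dom M := fun=> 0.
Definition senv0 : nat -> sets M := fun=> rset M.

Lemma basicP i : (i < 8)%N ->
  holds env0 senv0 (nth (fun _ _ => Imp Bot Bot) basic_axioms i 0%N 0%N).
Proof.
move=> i8; apply/holdsE/rmodel/RCA0_basic.
by do 8![case: i i8 => [_|i i8]; [do 8?[by left|right]|]].
Qed.

Lemma d_S0 x : x + 1 <> 0. Proof. exact: (@basicP 0%N isT x). Qed.
Lemma d_Sinj x y : x + 1 = y + 1 -> x = y.
Proof. exact: (@basicP 1%N isT x y). Qed.
Lemma d_add0 x : x + 0 = x. Proof. exact: (@basicP 2%N isT x). Qed.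
Lemma d_addS x y : x + (y + 1) = (x + y) + 1.
Proof. exact: (@basicP 3%N isT x y). Qed.
Lemma d_mul0 x : x * 0 = 0. Proof. exact: (@basicP 4%N isT x). Qed.
Lemma d_mulS x y : x * (y + 1) = (x * y) + x.
Proof. exact: (@basicP 5%N isT x y). Qed.
Lemma d_lt0 x : ~ x < 0. Proof. exact: (@basicP 6%N isT x). Qed.
Lemma d_ltS x y : x < y + 1 <-> x < y \/ x = y.
Proof.
have [/= H1 H2] : (x < y + 1 -> ~ x < y -> x = y) /\ ((~ x < y -> x = y) -> x <
  y + 1) :=
  @basicP 7%N isT x y.
split=> [/H1 H|[] xy]; last by refine (H2 _).
  by case: (pselect (x < y)) => [|/H]; [left|right].
by refine (H2 _) => /(_ xy).
Qed.

Definition env (s : seq D) : nat -> dom M := foldr (@scons (dom M)) env0 s.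

(** [Var 0] is the induction variable, and [Var 1], [Var 2], and so on are the parameters listed in
    [s]. *)
Lemma dind s p : isDelta00 p ->
  holds (scons 0 (env s)) senv0 p ->
  (forall n, holds (scons n (env s)) senv0 p -> holds (scons (n + 1) (env s))
    senv0 p) ->
  forall n, holds (scons n (env s)) senv0 p.
Proof. by apply: holds_delta_ind; apply: rmodel. Qed.

Lemma d_0add x : 0 + x = x.
Proof.
move: x; apply: (@dind [::] (Eq (Plus Zero (Var 0)) (Var 0)) isT) => /=.
  exact: d_add0.
by move=> n IH; rewrite d_addS IH.
Qed.

Lemma d_Sadd x y : (x + 1) + y = (x + y) + 1.
Proof.
move: y; apply: (@dind [:: x] (Eq (Plus (Plus (Var 1) One) (Var 0))
  (Plus (Plus (Var 1) (Var 0)) One)) isT) => /=; first by rewrite !d_add0.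
by move=> n IH; rewrite !d_addS IH.
Qed.

Lemma d_addC x y : x + y = y + x.
Proof.
move: y; apply: (@dind [:: x] (Eq (Plus (Var 1) (Var 0)) (Plus (Var 0) (Var
  1))) isT) => /=.
  by rewrite d_add0 d_0add.
by move=> n IH; rewrite d_addS IH d_Sadd.
Qed.

Lemma d_addA x y z : x + (y + z) = (x + y) + z.
Proof.
move: z; apply: (@dind [:: x; y] (Eq (Plus (Var 1) (Plus (Var 2) (Var 0)))
  (Plus (Plus (Var 1) (Var 2)) (Var 0))) isT) => /=; first by rewrite !d_add0.
by move=> n IH; rewrite !d_addS IH.
Qed.

Lemma d_addI x y z : x + z = y + z -> x = y.
Proof.
move: z; apply: (@dind [:: x; y] (Imp (Eq (Plus (Var 1) (Var 0)) (Plus (Var 2)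
  (Var 0)))
  (Eq (Var 1) (Var 2))) isT) => /=; first by rewrite !d_add0.
by move=> n IH; rewrite !d_addS => /d_Sinj.
Qed.

Lemma d_0mul x : 0 * x = 0.
Proof.
move: x; apply: (@dind [::] (Eq (Mult Zero (Var 0)) Zero) isT) => /=.
  exact: d_mul0.
by move=> n IH; rewrite d_mulS IH d_add0.
Qed.

Lemma d_Smul x y : (x + 1) * y = x * y + y.
Proof.
move: y; apply: (@dind [:: x] (Eq (Mult (Plus (Var 1) One) (Var 0))
  (Plus (Mult (Var 1) (Var 0)) (Var 0))) isT) => /=; first by rewrite !d_mul0
    d_add0.
by move=> n IH; rewrite !d_mulS IH !d_addS -(d_addA _ n x) (d_addC n) d_addA.
Qed.

Lemma d_mulC x y : x * y = y * x.
Proof.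
move: y; apply: (@dind [:: x] (Eq (Mult (Var 1) (Var 0)) (Mult (Var 0) (Var
  1))) isT) => /=.
  by rewrite d_mul0 d_0mul.
by move=> n IH; rewrite d_mulS IH d_Smul.
Qed.

Lemma d_1mul x : 1 * x = x.
Proof. by rewrite -(d_0add 1) d_Smul d_0mul d_0add. Qed.

Lemma d_mulDr x y z : x * (y + z) = x * y + x * z.
Proof.
move: z; apply: (@dind [:: x; y] (Eq (Mult (Var 1) (Plus (Var 2) (Var 0)))
  (Plus (Mult (Var 1) (Var 2)) (Mult (Var 1) (Var 0)))) isT) => /=.
  by rewrite d_mul0 !d_add0.
by move=> n IH; rewrite !d_addS !d_mulS IH d_addA.
Qed.

Lemma d_mulDl x y z : (y + z) * x = y * x + z * x.
Proof. by rewrite d_mulC d_mulDr !(d_mulC x). Qed.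

Lemma d_mulA x y z : x * (y * z) = (x * y) * z.
Proof.
move: z; apply: (@dind [:: x; y] (Eq (Mult (Var 1) (Mult (Var 2) (Var 0)))
  (Mult (Mult (Var 1) (Var 2)) (Var 0))) isT) => /=; first by rewrite !d_mul0.
by move=> n IH; rewrite !d_mulS d_mulDr IH.
Qed.

(** The existential quantifier is moved in front of the case distinction, which makes the induction
    formula Sigma01. *)
Lemma d_case x : x = 0 \/ exists y, x = y + 1.
Proof.
suff: exists y, x <> 0 -> x = y + 1.
  by case=> y H; case: (pselect (x = 0)) => [|/H]; [left|right; exists y].
move: x; apply: (holds_sigma_ind (@rmodel M) (e := env0) (f := senv0)
  (q := Imp (Neg (Eq (Var 1) Zero)) (Eq (Var 1) (Plus (Var 0) One))) isT) => /=.
  by exists 0.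
by move=> n _; exists n.
Qed.

Lemma d_lt_add x k : x < x + (k + 1).
Proof.
move: k; apply: (@dind [:: x] (Lt (Var 1) (Plus (Var 1) (Plus (Var 0) One)))
  isT) => /=.
  by rewrite d_addS; apply/d_ltS; right; rewrite d_add0.
by move=> n IH; rewrite d_addS; apply/d_ltS; left.
Qed.

Lemma d_ltP x y : x < y <-> exists k, x + (k + 1) = y.
Proof.
split=> [|[k <-]]; last exact: d_lt_add.
suff: exists k, x < y -> x + (k + 1) = y by case=> k H /H; exists k.
move: y; apply: (holds_sigma_ind (@rmodel M) (e := env [:: x]) (f := senv0)
  (q := Imp (Lt (Var 2) (Var 1)) (Eq (Plus (Var 2) (Plus (Var 0) One)) (Var
    1))) isT) => /=.
  by exists 0 => /d_lt0.
move=> n [k IH]; case: (pselect (x < n)) => [/IH <-|xn].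
  by exists (k + 1) => _; rewrite (d_addS x).
by exists 0 => /d_ltS[//|<-]; rewrite d_0add.
Qed.

(** One witness serves both cases: it is whichever difference exists. This merges a disjunction of
    two existential statements into one Sigma01 formula. *)
Lemma d_total x y : (exists k, x + k = y) \/ (exists k, y + (k + 1) = x).
Proof.
suff: exists k, x + k <> y -> y + k = x.
  case=> k H; case: (pselect (x + k = y)) => [|/[dup]K /H Hk].
    by left; exists k.
  case: (d_case k) Hk K => [->|[k' ->]] E K; last by right; exists k'.
  by case: K; rewrite -E !d_add0.
move: y; apply: (holds_sigma_ind (@rmodel M) (e := env [:: x]) (f := senv0)
  (q := Imp (Neg (Eq (Plus (Var 2) (Var 0)) (Var 1))) (Eq (Plus (Var 1) (Var
    0)) (Var 2))) isT) => /=.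
  by exists x => _; rewrite d_0add.
move=> n [k IH]; case: (pselect (x + k = n)) => [<-|/IH <-].
  by exists (k + 1); rewrite d_addS.
case: (d_case k) => [->|[j ->]]; first by exists 1; rewrite d_add0.
by exists j => _; rewrite d_addS d_Sadd.
Qed.

Lemma d_addeq0 x y : x + y = 0 -> x = 0.
Proof.
case: (d_case y) => [->|[z ->]]; first by rewrite d_add0.
by rewrite d_addS => /d_S0.
Qed.
End Arithmetic.

HB.instance Definition _ (M : rca) :=
  GRing.isNmodule.Build (nn M) (@d_addA M) (@d_addC M) (@d_0add M).

Lemma d_oner_neq0 (M : rca) : (dunit : nn M) != dzero.
Proof. by apply/eqP; rewrite -(d_0add dunit); apply: d_S0. Qed.

HB.instance Definition _ (M : rca) :=
  GRing.Nmodule_isComNzSemiRing.Build (nn M) (@d_mulA M) (@d_mulC M)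
    (@d_1mul M) (fun y z x => d_mulDl x y z) (@d_0mul M) (d_oner_neq0 M).

(** * The ordered field of fractions of a model *)
Local Open Scope ring_scope.

Section Fractions.
Variable M : rca.
Local Notation D := (nn M).
Implicit Types (a b c x y z : D).

Let addI x y z : x + z = y + z -> x = y := @d_addI M x y z.
Let total x y : (exists k, x + k = y) \/ (exists k, y + (k + 1) = x) :=
  d_total x y.
Let case0 x : x = 0 \/ exists y, x = y + 1 := @d_case M x.
Let S0 x : x + 1 <> 0 := @d_S0 M x.

Lemma nn_SmulI k x y : (k + 1) * x = (k + 1) * y -> x = y.
Proof.
wlog: x y / exists j, x + j = y.
  move=> H E; case: (total x y) => [xy|[j yx]]; first exact: H.
  by apply/esym/H => //; exists (j + 1).
case=> j <-; case: (case0 j) => [->|[i ->]]; first by rewrite addr0.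
have -> : (k + 1) * (x + (i + 1)) = (k * i + k + i + 1) + (k + 1) * x by ring.
by rewrite -[X in X = _ -> _]add0r => /addI /esym/S0.
Qed.

(* The triple (a, b, c) stands for (a - b) / (c + 1). *)
Definition preq (t u : D * D * D) : Prop :=
  let: (a, b, c) := t in let: (a', b', c') := u in
  a * (c' + 1) + b' * (c + 1) = a' * (c + 1) + b * (c' + 1).

Definition frac := quot preq.
Definition fcl : D * D * D -> frac := qcl preq.

Lemma fclE t u : fcl t = fcl u <-> preq t u.
Proof.
apply: qclE => {t u} [[[a b] c]|[[a b] c] [[a' b'] c']|[[a b] c] [[a' b'] c']
  [[a2 b2] c2]] //=.
(* Transitivity without subtraction: the middle denominator is cancelled as a factor, and the middle
   numerators are added to both sides. *)
move=> E1 E2; apply: (@nn_SmulI c').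
apply: (@addI _ _ (a' * (c + 1) * (c2 + 1) + b' * (c + 1) * (c2 + 1))).
transitivity ((c2 + 1) * (a * (c' + 1) + b' * (c + 1)) + (c + 1) * (a' * (c2 +
  1) + b2 * (c' + 1))).
  ring.
rewrite E1 E2; ring.
Qed.

Lemma fclP (x : frac) : exists a b c, x = fcl (a, b, c).
Proof. by rewrite -(qrepK x); case: (qrep x) => -[a b] c; exists a, b, c. Qed.

HB.instance Definition _ := gen_eqMixin frac.
HB.instance Definition _ := gen_choiceMixin frac.

Definition flift2 (h : D * D * D -> D * D * D -> D * D * D) (x y : frac) : frac
  :=
  fcl (h (qrep x) (qrep y)).

Lemma flift2E h : (forall t u t' u', preq t t' -> preq u u' -> preq (h t u) (h
  t' u')) ->
  forall t u, flift2 h (fcl t) (fcl u) = fcl (h t u).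
Proof. by move=> H t u; apply/fclE/H; apply/fclE; rewrite /fcl qrepK. Qed.

(** The denominators multiply: [c * c' + c + c' + 1 = (c + 1) * (c' + 1)]. *)
Definition tadd (t u : D * D * D) : D * D * D :=
  let: (a, b, c) := t in let: (a', b', c') := u in
  (a * (c' + 1) + a' * (c + 1), b * (c' + 1) + b' * (c + 1), c * c' + c + c').
Definition tmul (t u : D * D * D) : D * D * D :=
  let: (a, b, c) := t in let: (a', b', c') := u in
  (a * a' + b * b', a * b' + b * a', c * c' + c + c').

Definition fadd := flift2 tadd.
Definition fmul := flift2 tmul.
Definition fopp (x : frac) : frac :=
  let: (a, b, c) := qrep x in fcl (b, a, c).

Lemma faddE a b c a' b' c' : fadd (fcl (a, b, c)) (fcl (a', b', c')) =
  fcl (a * (c' + 1) + a' * (c + 1), b * (c' + 1) + b' * (c + 1), c * c' + c +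
    c').
Proof.
rewrite /fadd flift2E //= => -[[x1 x2] x3] [[y1 y2] y3] [[x1' x2'] x3'] [[y1'
  y2'] y3'] /= E1 E2.
transitivity ((y3 + 1) * (y3' + 1) * (x1 * (x3' + 1) + x2' * (x3 + 1))
  + (x3 + 1) * (x3' + 1) * (y1 * (y3' + 1) + y2' * (y3 + 1))); first by ring.
by rewrite E1 E2; ring.
Qed.

Lemma fmulE a b c a' b' c' : fmul (fcl (a, b, c)) (fcl (a', b', c')) =
  fcl (a * a' + b * b', a * b' + b * a', c * c' + c + c').
Proof.
rewrite /fmul flift2E // => -[[x1 x2] x3] [[y1 y2] y3] [[x1' x2'] x3'] [[y1'
  y2'] y3'] E1 E2.
rewrite /preq in E1 E2; apply/fclE; transitivity (fcl (tmul (x1', x2', x3')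
  (y1, y2, y3))); apply/fclE => /=.
  transitivity ((y3 + 1) * (y1 * (x1 * (x3' + 1) + x2' * (x3 + 1)) +
     y2 * (x1' * (x3 + 1) + x2 * (x3' + 1)))); first by ring.
  rewrite E1; symmetry; transitivity ((y3 + 1) * (y1 * (x1' * (x3 + 1) + x2 *
    (x3' + 1)) +
     y2 * (x1 * (x3' + 1) + x2' * (x3 + 1)))); first by ring.
  by rewrite E1.
transitivity ((x3' + 1) * (x1' * (y1 * (y3' + 1) + y2' * (y3 + 1)) +
     x2' * (y1' * (y3 + 1) + y2 * (y3' + 1)))); first by ring.
rewrite E2; symmetry.
transitivity ((x3' + 1) * (x1' * (y1' * (y3 + 1) + y2 * (y3' + 1)) +
     x2' * (y1 * (y3' + 1) + y2' * (y3 + 1)))); first by ring.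
by rewrite E2.
Qed.

Lemma foppE a b c : fopp (fcl (a, b, c)) = fcl (b, a, c).
Proof.
rewrite /fopp; case E : (qrep _) => [[a' b'] c'].
have /fclE /= H : fcl (a', b', c') = fcl (a, b, c) by rewrite -E /fcl qrepK.
by apply/fclE => /=; rewrite addrC -H addrC.
Qed.

Lemma faddA : associative fadd.
Proof.
move=> x y z; have [a [b [c ->]]] := fclP x; have [a' [b' [c' ->]]] := fclP y.
have [a2 [b2 [c2 ->]]] := fclP z; rewrite !faddE; apply/fclE => /=; ring.
Qed.

Lemma faddC : commutative fadd.
Proof.
move=> x y; have [a [b [c ->]]] := fclP x; have [a' [b' [c' ->]]] := fclP y.
rewrite !faddE; apply/fclE => /=; ring.
Qed.

Lemma fadd0 : left_id (fcl (0, 0, 0)) fadd.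
Proof.
by move=> x; have [a [b [c ->]]] := fclP x; rewrite faddE; apply/fclE => /=;
  ring.
Qed.

Lemma faddN : left_inverse (fcl (0, 0, 0)) fopp fadd.
Proof.
move=> x; have [a [b [c ->]]] := fclP x; rewrite foppE faddE.
by apply/fclE => /=; ring.
Qed.

HB.instance Definition _ := GRing.isZmodule.Build frac faddA faddC fadd0 faddN.

Lemma fmulA : associative fmul.
Proof.
move=> x y z; have [a [b [c ->]]] := fclP x; have [a' [b' [c' ->]]] := fclP y.
have [a2 [b2 [c2 ->]]] := fclP z; rewrite !fmulE; apply/fclE => /=; ring.
Qed.

Lemma fmulC : commutative fmul.
Proof.
move=> x y; have [a [b [c ->]]] := fclP x; have [a' [b' [c' ->]]] := fclP y.
rewrite !fmulE; apply/fclE => /=; ring.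
Qed.

Lemma fmul1 : left_id (fcl (1, 0, 0)) fmul.
Proof.
by move=> x; have [a [b [c ->]]] := fclP x; rewrite fmulE; apply/fclE => /=;
  ring.
Qed.

Lemma fmulDl : left_distributive fmul fadd.
Proof.
move=> x y z; have [a [b [c ->]]] := fclP x; have [a' [b' [c' ->]]] := fclP y.
have [a2 [b2 [c2 ->]]] := fclP z; rewrite ?(faddE, fmulE); apply/fclE => /=;
  ring.
Qed.

Lemma fone_neq0 : fcl (1, 0, 0) != 0.
Proof.
apply/eqP => /fclE H; apply: (@S0 0).
by transitivity (1 * (0 + 1) + 0 * (0 + 1) : D); [ring|rewrite [LHS]H; ring].
Qed.

HB.instance Definition _ :=
  GRing.Zmodule_isComNzRing.Build frac fmulA fmulC fmul1 fmulDl fone_neq0.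

Lemma finv_ex (x : frac) : exists y : frac, if x == 0 then y = 0 else y * x = 1.
Proof.
case: eqP => [_|]; first by exists 0.
have [a [b [c ->]]] := fclP x.
(* The sign of [a - b] decides whether [c + 1] enters the inverse negatively or positively; the
   difference, a successor, becomes its denominator. *)
case: (total a b) => -[k <-].
  case: (case0 k) => [->|[j ->] _].
    by case; apply/fclE => /=; ring.
  exists (fcl (0, c + 1, j)); rewrite [LHS]fmulE; apply/fclE => /=; ring.
move=> _; exists (fcl (c + 1, 0, k)); rewrite [LHS]fmulE; apply/fclE => /=;
  ring.
Qed.

Definition finv (x : frac) : frac := sval (cid (finv_ex x)).

Lemma fmulV (x : frac) : x != 0 -> finv x * x = 1.
Proof. by rewrite /finv; case: cid => y /=; case: eqP. Qed.

Lemma finv0 : finv 0 = 0.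
Proof. by rewrite /finv; case: cid => y /=; rewrite eqxx. Qed.

HB.instance Definition _ := GRing.ComNzRing_isField.Build frac fmulV finv0.

Definition fge0 (x : frac) : Prop :=
  exists b k c, x = fcl (b + k, b, c).

(** Independence of the representative: if [a] were smaller than [b], cross multiplication would
    make a successor equal to 0. *)
Lemma fge0E a b c : fge0 (fcl (a, b, c)) <-> exists k, b + k = a.
Proof.
split=> [[b' [k' [c' /fclE /= E]]]|[k <-]]; last by exists b, k, c.
case: (total b a) => // -[j bE]; exfalso; move: E; rewrite -bE => E.
apply: (@S0 (j * c' + j + c' + k' * c + k')).
apply: (@addI _ _ (a * (c' + 1) + b' * (c + 1))).
by rewrite add0r [RHS]E; ring.
Qed.

Definition fle (x y : frac) : bool := `[< fge0 (y - x) >].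
Definition flt (x y : frac) : bool := (y != x) && fle x y.
Definition fnorm (x : frac) : frac := if fle 0 x then x else - x.

Lemma fle0E (x : frac) : fle 0 x = `[< fge0 x >].
Proof. by rewrite /fle subr0. Qed.

Lemma fle0_add (x y : frac) : fle 0 x -> fle 0 y -> fle 0 (x + y).
Proof.
rewrite !fle0E => /asboolP[b [k [c ->]]] /asboolP[b' [k' [c' ->]]];
  apply/asboolP.
rewrite [_ + _]faddE; apply/fge0E; exists (k * (c' + 1) + k' * (c + 1)); ring.
Qed.

Lemma fle0_mul (x y : frac) : fle 0 x -> fle 0 y -> fle 0 (x * y).
Proof.
rewrite !fle0E => /asboolP[b [k [c ->]]] /asboolP[b' [k' [c' ->]]];
  apply/asboolP.
rewrite [_ * _]fmulE; apply/fge0E; exists (k * k'); ring.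
Qed.

Lemma fle0_anti (x : frac) : fle 0 x -> fle x 0 -> x = 0.
Proof.
rewrite fle0E /fle sub0r => /asboolP[b [k [c ->]]] /asboolP.
rewrite [- _]foppE => /fge0E[j E].
have -> : k = 0.
  apply: (@d_addeq0 M k j); change (k + j = 0).
  by apply: (@addI _ _ b); rewrite add0r -[RHS]E; ring.
by apply/fclE => /=; ring.
Qed.

Lemma fsub_ge0 (x y : frac) : fle 0 (y - x) = fle x y.
Proof. by rewrite /fle subr0. Qed.

Lemma fle0_total (x : frac) : fle 0 x || fle x 0.
Proof.
rewrite fle0E /fle sub0r; have [a [b [c ->]]] := fclP x.
case: (total b a) => -[k H]; apply/orP; [left|right]; apply/asboolP.
  by apply/fge0E; exists k.
by rewrite [- _]foppE; apply/fge0E; exists (k + 1).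
Qed.

Lemma fnormN (x : frac) : fnorm (- x) = fnorm x.
Proof.
rewrite /fnorm -(fsub_ge0 0 (- x)) subr0 -sub0r fsub_ge0.
case: ifP => x0; case: ifP => x1 //; rewrite ?sub0r ?opprK //.
  by rewrite (fle0_anti x1 x0) oppr0.
by have := fle0_total x; rewrite x0 x1.
Qed.

Lemma fge0_norm (x : frac) : fle 0 x -> fnorm x = x.
Proof. by rewrite /fnorm => ->. Qed.

HB.instance Definition _ := Num.IntegralDomain_isLeReal.Build frac
  fle0_add fle0_mul fle0_anti fsub_ge0 fle0_total fnormN fge0_norm
  (fun x y : frac => erefl (flt x y)).

Definition nat_frac (a : D) : frac := fcl (a, 0, 0).

Lemma nat_frac0 : nat_frac dzero = 0. Proof. by []. Qed.
Lemma nat_frac1 : nat_frac dunit = 1. Proof. by []. Qed.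

Lemma nat_fracD a b : nat_frac (dadd a b) = nat_frac a + nat_frac b.
Proof. by rewrite [RHS]faddE; apply/fclE => /=; rewrite -[dadd a b]/(a + b);
  ring. Qed.

Lemma nat_fracM a b : nat_frac (dmul a b) = nat_frac a * nat_frac b.
Proof. by rewrite [RHS]fmulE; apply/fclE => /=; rewrite -[dmul a b]/(a * b);
  ring. Qed.

Lemma nat_frac_inj : injective nat_frac.
Proof.
move=> a b /fclE H; transitivity (a * (0 + 1) + 0 * (0 + 1) : D); first by ring.
by rewrite [LHS]H; ring.
Qed.

Lemma nat_frac_leP a b : nat_frac a <= nat_frac b <-> exists k, a + k = b.
Proof.
have -> : (nat_frac a <= nat_frac b) = fle (nat_frac a) (nat_frac b) by [].
have -> : fle (nat_frac a) (nat_frac b) = `[< fge0 (fcl (b, a, 0)) >].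
  congr (`[< fge0 _ >]); rewrite [- _]foppE [LHS]faddE; apply/fclE => /=; ring.
by rewrite -(fge0E b a 0); split=> /asboolP.
Qed.

Lemma nat_frac_ltP a b : dlt a b <-> nat_frac a < nat_frac b.
Proof.
rewrite ltNge; split=> [/d_ltP[k <-]|ba].
  apply/negP => /nat_frac_leP[j E]; apply: (@S0 ((k : D) + j)).
  apply: (@addI _ _ a); rewrite add0r -[RHS]E -[dadd a _]/(a + ((k : D) + 1));
    ring.
apply/d_ltP; case: (total b a) => -[k E]; last by exists k.
by case/negP: ba; apply/nat_frac_leP; exists k.
Qed.

Lemma nat_frac_ge0 a : 0 <= nat_frac a.
Proof. by rewrite -nat_frac0; apply/nat_frac_leP; exists a; rewrite add0r. Qed.

Lemma nat_frac_discrete a b : nat_frac a < nat_frac b -> nat_frac a + 1 <=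
  nat_frac b.
Proof.
move=> /nat_frac_ltP/d_ltP[k <-]; rewrite !nat_fracD nat_frac1.
by have := nat_frac_ge0 k; lra.
Qed.
End Fractions.

(** * Rationals, reals and points in a model *)
Section Pairs.
Variable M : rca.
Local Notation D := (dom M).
Local Notation N := (@nat_frac M).
Implicit Types x y z : D.
Import Sem.

Lemma Nadd x y : N (dadd x y) = N x + N y. Proof. exact: nat_fracD. Qed.
Lemma Nmul x y : N (dmul x y) = N x * N y. Proof. exact: nat_fracM. Qed.
Lemma N0 : N dzero = 0. Proof. by []. Qed.
Lemma N1 : N dunit = 1. Proof. by []. Qed.
Definition NE := (Nadd, Nmul, N0, N1).

Lemma ltE x y : dlt x y <-> N x < N y. Proof. exact: nat_frac_ltP. Qed.

Lemma leE x y : Le x y <-> N x <= N y.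
Proof.
rewrite le_eqVlt; split=> [H|/orP[/eqP/nat_frac_inj-> //|/ltE xy]]; last by [].
case: (pselect (dlt x y)) => [/ltE->|/H->]; by rewrite ?eqxx ?orbT.
Qed.

(** With s = x + y, the code lies between s ^ 2 and s ^ 2 + s, below (s + 1) ^ 2; by discreteness it
    determines s, then x. *)
Lemma npair_inj x y x' y' : npair x y = npair x' y' -> x = x' /\ y = y'.
Proof.
move=> E; have {}E : N (npair x y) = N (npair x' y') by rewrite E.
rewrite /npair !NE in E.
have := nat_frac_ge0 (x : nn M); have := nat_frac_ge0 (x' : nn M).
have := nat_frac_ge0 (y : nn M); have := nat_frac_ge0 (y' : nn M) => y'0 y0 x'0
  x0.
have H : N x + N y = N x' + N y'.
  case: (ltgtP (N x + N y) (N x' + N y')) => //.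
    by rewrite -!Nadd => /nat_frac_discrete; rewrite !Nadd => H; nra.
  by rewrite -!Nadd => /nat_frac_discrete; rewrite !Nadd => H; nra.
rewrite H in E; have xE : N x = N x' by apply: addrI E.
by split; apply: nat_frac_inj => //; rewrite xE in H; apply: addrI H.
Qed.

(** Allows the components of a code to be sought by bounded quantifiers. For [y] it rests on y <= y
    ^ 2, which needs discreteness. *)
Lemma npair_le x y : N x <= N (npair x y) /\ N y <= N (npair x y).
Proof.
have x0 := nat_frac_ge0 (x : nn M); have y0 := nat_frac_ge0 (y : nn M).
rewrite /npair !NE; split; first by nra.
have [->|yn0] := eqVneq (N y) 0; first by nra.
have : N dzero < N y by rewrite N0 lt0r yn0.
move=> /nat_frac_discrete; rewrite N0 => H; nra.
Qed.

Definition rat_val (u : rat M) : frac M := (N (rpos u) - N (rneg u)) / N (rden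
  u).

Lemma rcode_inj (u v : rat M) : rcode u = rcode v -> u = v.
Proof.
case: u v => [m n p] [m' n' p'] /npair_inj[/npair_inj[/= -> ->] -> //].
Qed.

Lemma ratP_gt0 (u : rat M) : ratP u -> 0 < N (rden u). Proof. by move/ltE. Qed.

Lemma rat_ltE (u v : rat M) : ratP u -> ratP v -> rat_lt u v <-> rat_val u <
  rat_val v.
Proof.
move=> /ratP_gt0 u0 /ratP_gt0 v0; rewrite /rat_lt ltE /rat_val !NE.
rewrite ltr_pdivrMr // mulrAC ltr_pdivlMr // !mulrBl.
by split=> H; lra.
Qed.

Lemma rat_leE (u v : rat M) : ratP u -> ratP v -> rat_le u v <-> rat_val u <=
  rat_val v.
Proof.
move=> /ratP_gt0 u0 /ratP_gt0 v0; rewrite /rat_le leE /rat_val !NE.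
rewrite ler_pdivrMr // mulrAC ler_pdivlMr // !mulrBl.
by split=> H; lra.
Qed.

Lemma rat_addP (u v : rat M) : ratP u -> ratP v -> ratP (rat_add u v).
Proof. by move=> /ratP_gt0 u0 /ratP_gt0 v0; apply/ltE; rewrite !NE mulr_gt0.
  Qed.

Lemma rat_val_add (u v : rat M) : ratP u -> ratP v -> rat_val (rat_add u v) =
  rat_val u + rat_val v.
Proof.
move=> /ratP_gt0 u0 /ratP_gt0 v0; rewrite /rat_val /= !NE; field.
by rewrite !gt_eqF.
Qed.

Lemma rat_val_frac m p : rat_val (rat_frac m p) = N m / N p.
Proof. by rewrite /rat_val /= N0 subr0. Qed.

Lemma rat_posP_gt0 (u : rat M) : rat_posP u -> ratP u /\ 0 < rat_val u.
Proof.
move=> [u0 /ltE H]; split=> //; rewrite divr_gt0 ?subr_gt0 //.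
exact: ratP_gt0.
Qed.

Lemma leq_addP x y : N x <= N y -> exists k, y = dadd x k.
Proof. by move=> /nat_frac_leP[k <-]; exists k. Qed.

Lemma upper_bound2 x y : exists z j k, z = dadd x j /\ z = dadd y k.
Proof.
case: (leP (N x) (N y)) => [/leq_addP[k ->]|/ltW/leq_addP[k ->]].
  by exists (dadd x k), k, dzero; rewrite d_add0.
by exists (dadd y k), dzero, k; rewrite d_add0.
Qed.
End Pairs.

(** * Powers of 2, and reals as sequences of field elements *)

Section Powers.
Variable M : rca.
Local Notation D := (dom M).
Local Notation N := (@nat_frac M).
Import Sem.
Local Notation "x ∈ X" := (dmem x X) (at level 70).

Definition pairt (t u : tm) : tm := Plus (Mult (Plus t u) (Plus t u)) t.

Definition doubling (E : sets M) :=
  [/\ IsFun E (@IsNat M) (@IsNat M), npair dzero dunit ∈ E &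
    forall i j, npair i j ∈ E -> npair (dadd i dunit) (dmul (dadd dunit dunit)
      j) ∈ E].

(** Asserting a common value at [i] is Sigma01 and passes from [i] to its successor. Hence [Pow2],
    which quantifies over all such sets, can be evaluated in one fixed set. *)
Lemma doubling_agree E E' : doubling E -> doubling E' ->
  forall i, exists e, npair i e ∈ E /\ npair i e ∈ E'.
Proof.
move=> [_ E0 ES] [_ E'0 E'S].
apply: (holds_sigma_ind (@rmodel M) (e := env0 M)
  (f := scons E (scons E' (senv0 M)))
  (q := And (In (pairt (Var 1) (Var 0)) 0) (In (pairt (Var 1) (Var 0)) 1)) isT)
    => /=.
  by exists dunit.
by move=> n [e [/ES H /E'S H']]; eexists; split; [exact: H|exact: H'].
Qed.

Variable E : sets M.
Hypothesis HE : doubling E.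

Let Efun : IsFun E (@IsNat M) (@IsNat M). Proof. by case: HE. Qed.

Lemma pow_ex (k : D) : exists e, npair k e ∈ E.
Proof. by have [_ [H _]] := Efun; apply: H. Qed.

Definition pow (k : D) : D := sval (cid (pow_ex k)).

Lemma powP k : npair k (pow k) ∈ E. Proof. by rewrite /pow; case: cid. Qed.

Lemma powE k e : npair k e ∈ E <-> e = pow k.
Proof.
split=> [H|->]; last exact: powP.
by have [_ [_ uniq]] := Efun; apply: uniq H (powP k).
Qed.

Lemma Pow2E k e : Pow2 k e <-> e = pow k.
Proof.
split=> [[E' [E'f [E'0 [E'S ke]]]]|->].
  have HE' : doubling E' by [].
  have [e' [/powE <- ke']] := doubling_agree HE HE' k.
  by have [_ [_ uniq]] := E'f; apply: uniq ke ke'.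
by case: HE => _ E0 ES; exists E; do ![split=> //]; apply: powP.
Qed.

Lemma powS k : pow (dadd k dunit) = dmul (dadd dunit dunit) (pow k).
Proof. by case: HE => _ _ /(_ _ _ (powP k))/powE. Qed.

Lemma pow_gt0 k : 0 < N (pow k).
Proof.
suff: exists e, npair k e ∈ E /\ dlt dzero e by move=> [e [/powE <- /ltE]].
move: k; apply: (holds_sigma_ind (@rmodel M) (e := env0 M)
  (f := scons E (senv0 M))
  (q := And (In (pairt (Var 1) (Var 0)) 0) (Lt Zero (Var 0))) isT) => /=.
  exists dunit; split; first by case: HE.
  by apply/ltE; rewrite N0 N1 ltr01.
move=> n [e [H /ltE e0]]; exists (dmul (dadd dunit dunit) e); split.
  by case: HE => _ _; apply.
by apply/ltE; rewrite !NE mulr_gt0 // addr_gt0.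
Qed.

Lemma pow_mono k i : N (pow k) <= N (pow (dadd k i)).
Proof.
suff: exists e, npair (dadd k i) e ∈ E /\ dlt (pow k) (dadd e dunit).
  by move=> [e [/powE -> /d_ltS[/ltE/ltW//|->]]].
move: i; apply: (holds_sigma_ind (@rmodel M) (e := env [:: k; pow k])
  (f := scons E (senv0 M))
  (q := And (In (pairt (Plus (Var 2) (Var 1)) (Var 0)) 0)
            (Lt (Var 3) (Plus (Var 0) One))) isT) => /=.
  exists (pow k); rewrite d_add0; split; first exact: powP.
  by apply/ltE; rewrite !NE ltrDl.
move=> n [e [H /ltE e0]]; exists (dmul (dadd dunit dunit) e); split.
  by rewrite d_addS; case: HE => _ _; apply.
apply/ltE; move: e0; rewrite !NE => e0.
by have := nat_frac_ge0 (e : nn M); lra.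
Qed.

Definition hpow (k : D) : frac M := (N (pow k))^-1.

Lemma hpow_gt0 k : 0 < hpow k. Proof. by rewrite invr_gt0 pow_gt0. Qed.

Lemma hpowS k : hpow (dadd k dunit) = hpow k / 2.
Proof. by rewrite /hpow powS !NE invfM mulrC; congr (_ / _). Qed.

Lemma hpow_le k i : hpow (dadd k i) <= hpow k.
Proof. by rewrite lef_pV2 ?posrE ?pow_gt0 ?pow_mono. Qed.

Lemma rat_val_pow m k : rat_val (rat_frac m (pow k)) = N m * hpow k.
Proof. exact: rat_val_frac. Qed.

Lemma ratP_pow m k : ratP (rat_frac m (pow k)).
Proof. by apply/ltE; apply: pow_gt0. Qed.

(* The [k]-th approximation of the real [x] is a rational of value [v k]. *)
Definition reads (x : real M) (v : D -> frac M) :=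
  forall k, exists u, [/\ ratP u, rat_val u = v k & forall F, x k F <-> F u].

Lemma reads_ex (x : real M) :
  (forall k, exists u, ratP u /\ forall F, x k F <-> F u) -> exists v, reads x
    v.
Proof.
move=> H; exists (fun k => rat_val (sval (cid (H k)))) => k.
by case: cid => u /= [u0 uP]; exists u.
Qed.

Lemma reads_leE x v y w : reads x v -> reads y w ->
  (forall k, x k (fun u => y k (fun v => rat_le u (rat_add v (rat_frac (dadd
    dunit dunit) (pow k))))) <->
    v k <= w k + 2 * hpow k).
Proof.
move=> rx ry k; have [u [u0 <- uP]] := rx k; have [u' [u'0 <- u'P]] := ry k.
rewrite uP u'P rat_leE //; last by apply: rat_addP => //; apply: ratP_pow.
by rewrite rat_val_add ?rat_val_pow ?NE //; apply: ratP_pow.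
Qed.

Lemma real_leE x v y w : reads x v -> reads y w ->
  real_le x y <-> forall k, v k <= w k + 2 * hpow k.
Proof.
move=> rx ry; split=> H k.
  by have [e [/Pow2E -> /(reads_leE rx ry)]] := H k.
by exists (pow k); split; [apply/Pow2E|apply/(reads_leE rx ry)].
Qed.

Lemma real_ltE x v y w : reads x v -> reads y w ->
  real_lt x y <-> exists k, v k + 2 * hpow k < w k.
Proof.
move=> rx ry; split=> -[k H]; exists k.
  rewrite ltNge; apply/negP => /(reads_leE ry rx) K.
  by apply: (H (pow k)); split=> //; apply/Pow2E.
by move=> e [/Pow2E -> /(reads_leE ry rx)]; rewrite leNgt H.
Qed.

Lemma rapidE x v : reads x v -> RapidlyConverging x <->
  forall k i, v k <= v (dadd k i) + hpow k /\ v (dadd k i) <= v k + hpow k.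
Proof.
move=> rx.
have H k i : x k (fun u => x (dadd k i) (fun v =>
      rat_le u (rat_add v (rat_frac dunit (pow k))) /\
      rat_le v (rat_add u (rat_frac dunit (pow k))))) <->
    v k <= v (dadd k i) + hpow k /\ v (dadd k i) <= v k + hpow k.
  have [u [u0 <- uP]] := rx k; have [u' [u'0 <- u'P]] := rx (dadd k i).
  rewrite uP u'P !rat_leE // ?rat_val_add ?rat_val_pow ?NE ?mul1r //;
  by [apply: rat_addP => //; apply: ratP_pow|apply: ratP_pow].
split=> K k i; first by have [e [/Pow2E -> /H]] := K k i.
by exists (pow k); split; [apply/Pow2E|apply/H].
Qed.

Lemma reads_rat u : ratP u -> reads (real_of_rat u) (fun=> rat_val u).
Proof. by move=> u0 k; exists u. Qed.

Lemma reads_real0 : reads (@real0 M) (fun=> 0).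
Proof.
move=> k; exists (rat_frac dzero dunit); split=> //; last by rewrite
  rat_val_frac N0 mul0r.
by apply/ltE; rewrite N1 N0 ltr01.
Qed.

Lemma reads_add x v y w : reads x v -> reads y w ->
  reads (real_add x y) (fun k => v (dadd k dunit) + w (dadd k dunit)).
Proof.
move=> rx ry k; have [u [u0 uv uP]] := rx (dadd k dunit).
have [u' [u'0 u'v u'P]] := ry (dadd k dunit).
exists (rat_add u u'); split; [exact: rat_addP|by rewrite rat_val_add // uv
  u'v|].
by move=> F; rewrite /real_add uP u'P.
Qed.

(** Functionality of [X] and injectivity of [rcode] leave one triple at [x], so the quantifier over
    rationals amounts to evaluation there. *)
Lemma rat_fun_value X Dom x : IsFun X Dom (@IsQ M) -> Dom x ->
  exists u, ratP u /\ forall F : rat M -> Prop,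
    ExQ (fun u => npair x (rcode u) ∈ X /\ F u) <-> F u.
Proof.
move=> [X1 [X2 X3]] /X2[y xy].
have [x' [y' [/npair_inj[_ yE] [_ [m [n [p [p0 y'E]]]]]]]] := X1 _ xy.
rewrite yE y'E in xy; exists (Rat m n p); split=> // F; split.
  by move=> [m' [n' [p' [_ [/(X3 _ _ _ xy)/rcode_inj <-]]]]].
by move=> Fu; exists m, n, p.
Qed.

Lemma reads_set X : IsFun X (@IsNat M) (@IsQ M) ->
  exists v, reads (real_of_set X) v.
Proof. by move=> Xf; apply: reads_ex => k; apply: (rat_fun_value Xf). Qed.

Lemma reads_mdist d A a b :
  IsFun d (fun z => exists a b k,
    z = npair (npair a b) k /\ a ∈ A /\ b ∈ A) (@IsQ M) ->
  a ∈ A -> b ∈ A -> exists v, reads (mdist d a b) v.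
Proof.
move=> df aA bA; apply: reads_ex => k.
by apply: (rat_fun_value df); exists a, b, k.
Qed.
End Powers.

Definition fBEx (t : num) (F : num -> fm) : fm :=
  (~ (ALL1 x, x < t ⇒ ~ F x))%fm.

(* Number parameters: the term [x_n], the index [n] and the value [2 ^ n];
   set parameters: the point, the distance and the graph of powers of 2. *)
Definition far_formula : form :=
  let x := svar 0 in let d := svar 1 in let E := svar 2 in
  let a := nvar 0 in let n := nvar 1 in let e1 := nvar 2 in
  let i := nvar 3 in let w := nvar 4 in
  fBEx w (fun b => fBEx w (fun k => fBEx w (fun u1 => fBEx w (fun u2 =>
  fBEx w (fun u3 => fBEx w (fun e2 => fBEx w (fun e3 =>
    (⟨n + (i + 1), b⟩ \in x /\ ⟨⟨a, b⟩, k, rcode (Rat u1 u2 u3)⟩ \in d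
     /\ ratP (Rat u1 u2 u3) /\ ⟨n + (i + 1), e2⟩ \in E /\ ⟨k, e3⟩ \in E
     /\ rat_lt (rat_add (rat_add (Rat u1 u2 u3) (rat_frac 2 e3)) (rat_frac 2
       e2))
               (rat_frac 2 e1))%fm))))))) 5%N 3%N.

(* Number parameters: a default center [a0], the code [c0] of a default radius
   and the denominator of [q0]; set parameter: the code of the function. *)
Definition cover_formula : form :=
  let P := svar 0 in let a0 := nvar 0 in let c0 := nvar 1 in
  let p0 := nvar 2 in let z := nvar 3 in
  let good m a q : fm := fAnd (fIn m P)
    (fBEx (nadd m n1) (fun n => fBEx (nadd m n1) (fun b => fBEx (nadd m n1)
      (fun s1 =>
     fBEx (nadd m n1) (fun s2 => fBEx (nadd m n1) (fun s3 =>
       (m = ⟨n, a, q, b, rcode (Rat s1 s2 s3)⟩ /\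
        rat_lt (Rat s1 s2 s3) (rat_frac 1 p0))%fm)))))) in
  fBEx (nadd z n1) (fun m => fBEx (nadd z n1) (fun k => fBEx (nadd z n1) (fun a
    =>
  fBEx (nadd z n1) (fun q =>
    (z = ⟨⟨m, k⟩, ⟨a, q⟩⟩ /\
     (good m a q \/
      (~ fBEx (m + 1) (fun a' => fBEx (m + 1) (fun q' => good m a' q')))
      /\ a = a0 /\ q = c0))%fm)))) 4%N 1%N.

(** * Approximate distances and points of a space *)

Section Spaces.
Variable M : rca.
Local Notation D := (dom M).
Local Notation N := (@nat_frac M).
Import Sem.
Local Notation "x ∈ X" := (dmem x X) (at level 70).
Local Notation "x +' y" := (dadd x y) (at level 50, left associativity).
Local Notation one := (@dunit M).
Variable E : sets M.
Hypothesis HE : doubling E.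
Local Notation h := (hpow HE).
Local Notation reads := (@reads M).

(** [δ a b k] is the value of the [k]-th approximation of d(a, b). The slack [2 * h k] is that of
    [real_le], and the index [k +' one] that of [real_add]. *)
Record metric (A d : sets M) (δ : D -> D -> D -> frac M) : Prop := {
  m_reads : forall a b, a ∈ A -> b ∈ A -> reads (mdist d a b) (δ a b);
  m_rapid : forall a b k i, a ∈ A -> b ∈ A ->
    δ a b k <= δ a b (k +' i) + h k /\ δ a b (k +' i) <= δ a b k + h k;
  m_refl : forall a k, a ∈ A -> δ a a k <= 2 * h k;
  m_sym : forall a b k, a ∈ A -> b ∈ A -> δ a b k <= δ b a k + 2 * h k;
  m_tri : forall a b c k, a ∈ A -> b ∈ A -> c ∈ A ->
    δ a b k <= δ a c (k +' one) + δ c b (k +' one) + 2 * h k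
}.

Lemma space_metric A d : IsSpace A d -> exists δ, metric A d δ.
Proof.
move=> [fd [rap [refl [sym tri]]]].
have /choice[f fP] (p : D * D) : exists v,
    p.1 ∈ A -> p.2 ∈ A -> reads (mdist d p.1 p.2) v.
  case: p => a b /=.
  case: (pselect (a ∈ A /\ b ∈ A)) => [[aA bA]|no].
    by have [v vP] := reads_mdist fd aA bA; exists v.
  by exists (fun=> 0) => aA bA; case: no.
have rd a b (aA : a ∈ A) (bA : b ∈ A) : reads (mdist d a b) (f (a, b)).
  exact: (fP (a, b)).
exists (fun a b => f (a, b)); split=> //.
- move=> a b k i aA bA; exact: (rapidE HE (rd _ _ aA bA)).1 (rap _ _ aA bA) k i.
- move=> a k aA; have [H _] := refl a aA; rewrite -[leRHS]add0r.
  exact: (real_leE HE (rd _ _ aA aA) (@reads_real0 M)).1 H k.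
- move=> a b k aA bA; have [[H _] _] := sym a b aA bA.
  exact: (real_leE HE (rd _ _ aA bA) (rd _ _ bA aA)).1 H k.
- move=> a b c k aA bA cA; have H := tri a b c aA bA cA.
  exact: (real_leE HE (rd _ _ aA bA) (reads_add (rd _ _ aA cA) (rd _ _ cA
    bA))).1 H k.
Qed.

Section Metric.
Variables (A d : sets M) (δ : D -> D -> D -> frac M).
Hypothesis dδ : metric A d δ.

(* [near a b c] means that the distance of [a] and [b] is less than [c]. *)
Definition near (a b : D) (c : frac M) := exists k, δ a b k + 2 * h k < c.

Lemma near_le a b c c' : c <= c' -> near a b c -> near a b c'.
Proof. by move=> cc' [k H]; exists k; apply: lt_le_trans cc'. Qed.

Lemma near_sym a b c : a ∈ A -> b ∈ A -> near a b c -> near b a c.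
Proof.
(* Two indices later, the slack of symmetry and that of [near] are [h k / 2] each; with the drift
   [h k] they use up the available [2 * h k]. *)
move=> aA bA [k H]; exists (k +' one +' one).
have := m_sym dδ (k +' one +' one) bA aA.
have [_] := m_rapid dδ k (one +' one) aA bA; rewrite d_addA !hpowS.
by have := hpow_gt0 HE k; lra.
Qed.

Lemma near_tri a b c x y : a ∈ A -> b ∈ A -> c ∈ A ->
  near a c x -> near c b y -> near a b (x + y).
Proof.
move=> aA bA cA [k Hk] [k' Hk']; have [z [j [j' [zj zj']]]] := upper_bound2 k
  k'.
(* One step beyond both indices, the slacks of the triangle inequality and of [near] add up to
   [2 * h z], at most [h k + h k']; the two drifts take the rest. *)
exists (z +' one); have := m_tri dδ (z +' one) aA bA cA.
have [_] := m_rapid dδ k (j +' one +' one) aA cA.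
have [_] := m_rapid dδ k' (j' +' one +' one) cA bA.
have := hpow_le HE k j; have := hpow_le HE k' j'.
rewrite !d_addA -zj -zj' !hpowS; lra.
Qed.

Lemma near_approx a b c k : a ∈ A -> b ∈ A -> near a b c -> δ a b k < c + h k.
Proof.
move=> aA bA [m Hm]; have [z [j [j' [zj zj']]]] := upper_bound2 k m.
have [] := m_rapid dδ k j aA bA; have [_] := m_rapid dδ m j' aA bA.
by rewrite -zj -zj'; have := hpow_gt0 HE m; lra.
Qed.

Record point_seq (X : sets M) (x : D -> D) : Prop := {
  p_mem : forall k, x k ∈ A;
  p_reads : forall k F, point_of_set X k F <-> F (x k);
  p_graph : forall k a, npair k a ∈ X <-> a = x k;
  p_near : forall k, near (x k) (x (k +' one)) (h k)
}.

Lemma point_seq_ex X : IsPoint A d X -> exists x, point_seq X x.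
Proof.
move=> [[X1 [X2 X3]] X4].
have /choice[x xP] k : exists a, npair k a ∈ X by apply: X2.
have xg k a : npair k a ∈ X <-> a = x k.
  by split=> [H|->//]; apply: X3 H (xP k).
have xA k : x k ∈ A.
  by have [k' [a [/npair_inj[_ ->] []]]] := X1 _ (xP k).
exists x; split=> //.
- move=> k F; split=> [[a [/xg ->]]//|Fx]; by exists (x k).
- move=> k; have [e [/(Pow2E HE) ->]] := X4 _ _ _ (xP k) (xP (k +' one)).
  move=> /(real_ltE HE (m_reads dδ (xA _) (xA _)) (reads_rat (ratP_pow HE one
    k))).
  by case=> j; rewrite rat_val_pow N1 mul1r => H; exists j.
Qed.

(** The bound is the exact geometric sum of the steps [h n], ..., [h (n +' i)]; a plain [2 * h n]
    would not survive the induction step. *)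
Lemma point_far X x : point_seq X x -> forall n i,
  near (x n) (x (n +' (i +' one))) (2 * h n - 2 * h (n +' (i +' one))).
Proof.
move=> px n.
(* The bound as a Sigma01 property: one approximation [u] witnesses the strict inequality, and a
   single [w] bounds all the numbers involved, powers of 2 included. *)
pose far i := exists w, exists b, dlt b w /\ exists k, dlt k w /\
  exists u1, dlt u1 w /\ exists u2, dlt u2 w /\ exists u3, dlt u3 w /\
  exists e2, dlt e2 w /\ exists e3, dlt e3 w /\
  (npair (n +' (i +' one)) b ∈ X /\
   npair (npair (npair (x n) b) k) (rcode (Rat u1 u2 u3)) ∈ d /\
   ratP (Rat u1 u2 u3) /\ npair (n +' (i +' one)) e2 ∈ E /\ npair k e3 ∈ E /\
   rat_lt (rat_add (rat_add (Rat u1 u2 u3) (rat_frac (one +' one) e3))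
      (rat_frac (one +' one) e2)) (rat_frac (one +' one) (pow HE n))).
have farE i : far i <-> near (x n) (x (n +' (i +' one))) (2 * h n - 2 * h (n +'
  (i +' one))).
  have [xn xi] := (p_mem px n, p_mem px (n +' (i +' one))).
  have lt_le k (u : rat M) : ratP u -> 
      rat_lt (rat_add (rat_add u (rat_frac (one +' one) (pow HE k)))
      (rat_frac (one +' one) (pow HE (n +' (i +' one))))) (rat_frac (one +'
        one) (pow HE n)) <->
      rat_val u + 2 * h k < 2 * h n - 2 * h (n +' (i +' one)).
    move=> u0; have r1 := rat_addP u0 (ratP_pow HE (one +' one) k).
    have r2 := rat_addP r1 (ratP_pow HE (one +' one) (n +' (i +' one))).
    rewrite rat_ltE ?rat_val_add ?rat_val_pow ?NE //; try exact: ratP_pow.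
    by split; lra.
  split.
    move=> [w [b [_ [k [_ [u1 [_ [u2 [_ [u3 [_ [e2 [_ [e3 [_]]]]]]]]]]]]]]].
    move=> [/(p_graph px) -> [ud [u0 [/(powE HE) -> [/(powE HE) ->]]]]] /(lt_le
      _ _ u0) H.
    exists k; have [u [u'0 <- uP]] := m_reads dδ xn xi k.
    suff -> : u = Rat u1 u2 u3 by [].
    apply/esym; apply: ((uP (eq (Rat u1 u2 u3))).1).
    by exists u1, u2, u3.
  move=> [k H]; have [[u1 u2 u3] [u0 uv uP]] := m_reads dδ xn xi k.
  rewrite -uv in H.
  have [m [n' [p [_ [ud uE]]]]] := (uP (eq (Rat u1 u2 u3))).2 erefl.
  rewrite -uE in ud.
  pose e2 := pow HE (n +' (i +' one)); pose e3 := pow HE k.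
  pose b := x (n +' (i +' one)).
  pose w := b +' k +' u1 +' u2 +' u3 +' e2 +' e3 +' one.
  have [b0 k0] := (nat_frac_ge0 (b : nn M), nat_frac_ge0 (k : nn M)).
  have [v1 v2] := (nat_frac_ge0 (u1 : nn M), nat_frac_ge0 (u2 : nn M)).
  have [v3 v4] := (nat_frac_ge0 (u3 : nn M), nat_frac_ge0 (e2 : nn M)).
  have v5 := nat_frac_ge0 (e3 : nn M).
  exists w, b; split; first by apply/ltE; rewrite !NE; lra.
  exists k; split; first by apply/ltE; rewrite !NE; lra.
  exists u1; split; first by apply/ltE; rewrite !NE; lra.
  exists u2; split; first by apply/ltE; rewrite !NE; lra.
  exists u3; split; first by apply/ltE; rewrite !NE; lra.
  exists e2; split; first by apply/ltE; rewrite !NE; lra.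
  exists e3; split; first by apply/ltE; rewrite !NE; lra.
  do ![split=> //]; first exact/(p_graph px).
  - exact: powP.
  - exact: powP.
  - by apply/lt_le.
move=> i; apply/farE; move: i.
apply: (holds_sigma_ind (@rmodel M) (e := env [:: pow HE n; n; x n])
  (f := scons E (scons d (scons X (senv0 M)))) (q := far_formula) isT).
- apply/(farE dzero); rewrite (d_0add (one : nn M)) hpowS.
  by apply: near_le (p_near px n); have := hpow_gt0 HE n; lra.
- move=> i /(farE i) H; apply/(farE (i +' one)).
  have := near_tri (p_mem px _) (p_mem px _) (p_mem px _) H (p_near px _).
  rewrite -(d_addA n); apply: near_le.
  by rewrite (d_addA n (i +' one)) hpowS; lra.
Qed.
End Metric.
End Spaces.

(** * The covering of a continuous function *)
Section Main.
Variable M : rca.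
Local Notation D := (dom M).
Local Notation N := (@nat_frac M).
Import Sem.
Local Notation "x ∈ X" := (dmem x X) (at level 70).
Local Notation "x +' y" := (dadd x y) (at level 50, left associativity).
Local Notation one := (@dunit M).
Local Notation two := (dadd one one).
Local Notation four := (dadd two two).

Lemma npair_lt_S x y m : dlt (npair x y) (m +' one) ->
  dlt x (m +' one) /\ dlt y (m +' one).
Proof.
have [Hx Hy] := npair_le x y; move=> /ltE H.
by split; apply/ltE; [apply: le_lt_trans Hx H|apply: le_lt_trans Hy H].
Qed.

Lemma lt_S (x : D) : dlt x (x +' one).
Proof. by apply/ltE; rewrite !NE ltrDl. Qed.

Definition good (P : sets M) (p0 m a q : D) := m ∈ P /\ exists n b s,
  m = npair (npair (npair (npair n a) q) b) (rcode s) /\ rat_lt s (rat_frac one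
    p0).

(** Everything to be decoded from [z] or [m] is at most that code, so each quantifier can be bounded
    and the description is Delta00. The index [k] is free: the sequence coding U_m repeats one
    ball. *)
Lemma cover_set P p0 a0 c0 : exists U,
  (forall z, z ∈ U -> exists m k a q, z = npair (npair m k) (npair a q)) /\
  forall m k a q, npair (npair m k) (npair a q) ∈ U <->
    good P p0 m a q \/ (~ exists a q, good P p0 m a q) /\ a = a0 /\ q = c0.
Proof.
have [U HU] := holds_delta_comp (@rmodel M) (env [:: p0; c0; a0]) (scons P
  (senv0 M))
  (isT : isDelta00 cover_formula).
pose bgood m a q := m ∈ P /\ exists n, dlt n (m +' one) /\ exists b, dlt b (m
  +' one) /\
  exists s1, dlt s1 (m +' one) /\ exists s2, dlt s2 (m +' one) /\
  exists s3, dlt s3 (m +' one) /\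
  (m = npair (npair (npair (npair n a) q) b) (rcode (Rat s1 s2 s3)) /\
   rat_lt (Rat s1 s2 s3) (rat_frac one p0)).
have {}HU z : z ∈ U <-> exists m, dlt m (z +' one) /\ exists k, dlt k (z +'
  one) /\
    exists a, dlt a (z +' one) /\ exists q, dlt q (z +' one) /\
    (z = npair (npair m k) (npair a q) /\
     (~ bgood m a q -> (~ exists a', dlt a' (m +' one) /\ exists q', dlt q' (m
       +' one) /\ bgood m a' q') /\
       a = a0 /\ q = c0)) := HU z.
have goodE m a q : bgood m a q <-> good P p0 m a q.
  split=> [[mP [n [_ [b [_ [s1 [_ [s2 [_ [s3 [_ [mE H]]]]]]]]]]]]|[mP [n [b
    [[s1 s2 s3] [mE H]]]]]].
    by split=> //; exists n, b, (Rat s1 s2 s3).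
  have := lt_S m; rewrite {1}mE =>
    /npair_lt_S[/npair_lt_S[/npair_lt_S[/npair_lt_S[? ?] ?] ?]].
  move=> /npair_lt_S[/npair_lt_S[? ?] ?].
  by split=> //; exists n; split=> //; exists b; split=> //; exists s1; split=>
    //;
    exists s2; split=> //; exists s3.
have good_lt m a q : good P p0 m a q -> dlt a (m +' one) /\ dlt q (m +' one).
  move=> [mP [n [b [s [mE H]]]]].
  by have := lt_S m; rewrite {1}mE =>
    /npair_lt_S[/npair_lt_S[/npair_lt_S[/npair_lt_S[? ?] ?] ?]].
exists U; split; first by move=> z /HU[m [_ [k [_ [a [_ [q [_ [zE _]]]]]]]]];
  exists m, k, a, q.
have exE m : (exists a', dlt a' (m +' one) /\ exists q', dlt q' (m +' one) /\
  bgood m a' q') <->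
    exists a q, good P p0 m a q.
  split=> [[a [_ [q [_ /goodE H]]]]|[a [q H]]]; first by exists a, q.
  by have [? ?] := good_lt _ _ _ H; exists a; split=> //; exists q; split=> //;
    apply/goodE.
move=> m k a q; rewrite HU; split.
  move=> [m' [_ [k' [_ [a' [_ [q' [_ [/npair_inj[/npair_inj[<- _] /npair_inj[<-
    <-]]]]]]]]]]].
  rewrite exE goodE => H.
  by case: (pselect (good P p0 m a q)) => [|/H]; [left|right].
move=> H; have := lt_S (npair (npair m k) (npair a q)).
move=> /[dup] /npair_lt_S[/npair_lt_S[? ?] /npair_lt_S[? ?]] _.
exists m; split=> //; exists k; split=> //; exists a; split=> //; exists q; do
  2![split=> //].
by rewrite exE goodE; case: H.
Qed.

Variable E : sets M.
Hypothesis HE : doubling E.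
Local Notation h := (hpow HE).
Local Notation metric := (metric HE).

Section Distances.
Variables (A d : sets M) (δ : D -> D -> D -> frac M).
Hypothesis dδ : metric A d δ.

Definition preads (p : point M) (x : D -> D) :=
  (forall k, x k ∈ A) /\ forall k F, p k F <-> F (x k).

Lemma preads_elt a : a ∈ A -> preads (point_of_elt a) (fun=> a).
Proof. by []. Qed.

Lemma point_seq_preads X x : point_seq HE A δ X x -> preads (point_of_set X) x.
Proof. by case. Qed.

Lemma reads_pdist p q x y : preads p x -> preads q y ->
  reads (pdist d p q) (fun k => δ (x (k +' four)) (y (k +' four)) (k +' two)).
Proof.
move=> [xA px] [yA qy] k.
have [u [u0 uv uP]] := m_reads dδ (xA (k +' four)) (yA (k +' four)) (k +' two).
exists u; split=> // F; rewrite /pdist px qy; exact: uP.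
Qed.

(* Uniform in the index [j], which is what lets two such bounds be added. *)
Lemma pdist_lt_near X x b s : point_seq HE A δ X x -> b ∈ A -> ratP s ->
  real_lt (pdist d (point_of_set X) (point_of_elt b)) (real_of_rat s) ->
  exists k, forall j, near HE δ (x (k +' four +' (j +' one))) b (rat_val s - h
    k).
Proof.
move=> px bA s0.
have rp := reads_pdist (point_seq_preads px) (preads_elt bA).
move=> /(real_ltE HE rp (reads_rat s0))[k H]; exists k => j.
(* [pdist] reads [δ] at index [k +' two], where the slack of [near] is only [h k / 2] out of the
   given [2 * h k]. Later terms of the point move by less than [2 * h (k +' four) = h k / 8], which
   still leaves [h k]. *)
have near1 : near HE δ (x (k +' four)) b (rat_val s - 3 / 2 * h k).
  exists (k +' two); have -> : h (k +' two) = h k / 4 by rewrite !d_addA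
    !hpowS; field.
  by move: H; have := hpow_gt0 HE k; lra.
have xA := p_mem px.
have := near_tri dδ (xA _) bA (xA _)
  (near_sym dδ (xA _) (xA _) (point_far dδ px (k +' four) j)) near1.
apply: near_le; have := hpow_gt0 HE (k +' four +' (j +' one)).
have -> : h (k +' four) = h k / 16.
  by rewrite !d_addA !hpowS; field.
by have := hpow_gt0 HE k; lra.
Qed.

(** Beyond [l] the approximations of [eps] stay above [v l - h l], hence above [h l], which exceeds
    [2 * s]. The margins [h k] and [h k'] pay for reading the distance of the two points at a finite
    index. *)
Lemma near_pdist_lt X x Y y b s k k' eps v l :
  point_seq HE A δ X x -> point_seq HE A δ Y y -> b ∈ A ->
  (forall j, near HE δ (x (k +' four +' (j +' one))) b (s - h k)) ->
  (forall j, near HE δ (y (k' +' four +' (j +' one))) b (s - h k')) ->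
  reads eps v -> RapidlyConverging eps -> 2 * h l < v l -> s < h l / 2 ->
  real_lt (pdist d (point_of_set X) (point_of_set Y)) eps.
Proof.
move=> px py bA nx ny re /(rapidE HE re) rap vl sl.
have [z1 [j1 [j2 [z1E z1E']]]] := upper_bound2 k k'.
have [z [j3 [j4 [zE zE']]]] := upper_bound2 z1 l.
apply/(real_ltE HE (reads_pdist (point_seq_preads px) (point_seq_preads py))
  re).
have [xA yA] := (p_mem px, p_mem py).
exists (z +' one).
(* Brings the term read by [pdist] at index [z +' one] into the form in which both nearness
   hypotheses are given. *)
have shift i j : z +' one = i +' (j +' one) -> z +' one +' four = i +' four +'
  (j +' one).
  by move=> ->; rewrite -(d_addA i) (d_addC (j +' one)) (d_addA i).
have E1 : z +' one = k +' (j1 +' j3 +' one) by rewrite zE z1E !d_addA.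
have E2 : z +' one = k' +' (j2 +' j3 +' one) by rewrite zE z1E' !d_addA.
have E3 : z +' one = l +' (j4 +' one) by rewrite zE' !d_addA.
have := near_tri dδ (xA _) (yA _) bA (nx (j1 +' j3))
  (near_sym dδ (yA _) bA (ny (j2 +' j3))).
rewrite -(shift _ _ E1) -(shift _ _ E2) => nxy.
have := near_approx dδ (z +' one +' two) (xA _) (yA _) nxy.
have [H1 _] := rap l (j4 +' one); rewrite -E3 in H1.
have := hpow_le HE k (j1 +' j3); have := hpow_le HE k' (j2 +' j3).
have -> : k +' (j1 +' j3) = z by rewrite zE z1E !d_addA.
have -> : k' +' (j2 +' j3) = z by rewrite zE z1E' !d_addA.
have -> : h (z +' one +' two) = h z / 8 by rewrite !d_addA !hpowS; field.
rewrite hpowS; have := hpow_gt0 HE z; lra.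
Qed.

(** Needed to see that the center of a ball of Lebesgue radius itself lies in the chosen open set.
    At [l +' two] the errors sum to [5 / 8 * h l], while [q] is still above [h l]. *)
Lemma pdist_refl_lt X x q v : point_seq HE A δ X x ->
  reads q v -> RapidlyConverging q -> real_lt (@real0 M) q ->
  real_lt (pdist d (point_of_set X) (point_of_set X)) q.
Proof.
move=> px rq /(rapidE HE rq) rap /(real_ltE HE (@reads_real0 M) rq)[l].
rewrite add0r => vl.
have pr := point_seq_preads px; apply/(real_ltE HE (reads_pdist pr pr) rq).
exists (l +' two); have := m_refl dδ (l +' two +' two) (p_mem px (l +' two +'
  four)).
have [] := rap l two.
have -> : h (l +' two +' two) = h l / 16 by rewrite !d_addA !hpowS; field.
have -> : h (l +' two) = h l / 4 by rewrite !d_addA !hpowS; field.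
have := hpow_gt0 HE l; lra.
Qed.
End Distances.

Lemma lebesgue_atsuji (A d : sets M) :
  IsSpace A d -> Lebesgue A d -> Atsuji A d.
Proof.
move=> spA leb B d' spB P [P1 [_ [_ [_ P5]]]] eps epsR eps_gt0.
have [δ dδ] := space_metric HE spA; have [δ' dδ'] := space_metric HE spB.
have [v rv_eps] := reads_set epsR.1.
have [l] := (real_ltE HE (@reads_real0 M) rv_eps).1 eps_gt0; rewrite add0r =>
  vl.
(* The default ball comes from continuity at some point; in a space without points any positive real
   will do, for instance [eps]. *)
case: (pselect (exists X, IsPoint A d X)) => [[X0 X0P]|noX]; last first.
  by exists eps; do 2![split=> //]; move=> X XP; case: noX; exists X.
(* From [2 * h l < v l] and an error of at most [h l], [eps] exceeds [h l]; this is twice [q0]. *)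
pose p0 := dmul two (pow HE l); pose q0 := rat_frac one p0.
have p0_gt0 : 0 < N p0 by rewrite !NE mulr_gt0 ?pow_gt0 // addr_gt0.
have q0E : rat_val q0 = h l / 2 by rewrite rat_val_frac !NE div1r invfM mulrC.
have q0P : rat_posP q0.
  by split; apply/ltE => //=; rewrite N0 N1 ltr01.
have [a0 [b0 [r1 [r2 [r3 [r0 [s1 [s2 [s3 [s0 [[n0 cr0] [_ sq0]]]]]]]]]]]] := P5
  X0 X0P _ _ _ q0P.
have codeP n a q b s : npair (npair (npair (npair n a) q) b) (rcode s) ∈ P ->
    [/\ a ∈ A, b ∈ B, IsQpos q & rat_posP s].
  move=> /P1[n' [a' [q' [b' [s' [mE [aA [qQ [bB sQ]]]]]]]]].
  move: mE => /npair_inj[/npair_inj[/npair_inj[/npair_inj[_ ->] ->] ->] sE].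
  by have [m1 [m2 [m3 [sp sE']]]] := sQ; rewrite sE' in sE; rewrite (rcode_inj
    sE).
pose c0 := rcode (Rat r1 r2 r3).
have [U [U1 U2]] := cover_set P p0 a0 c0.
pose W m a q := good P p0 m a q \/ (~ exists a q, good P p0 m a q) /\ a = a0 /\
  q = c0.
have goodW m a q : good P p0 m a q -> exists n b s, [/\ 
    npair (npair (npair (npair n a) q) b) (rcode s) ∈ P & rat_lt s q0].
  by move=> [mP [n [b [s [mE H]]]]]; exists n, b, s; rewrite -mE.
have WP m a q : W m a q -> exists n b s, [/\ 
    npair (npair (npair (npair n a) q) b) (rcode s) ∈ P & rat_lt s q0].
  case=> [/goodW//|[_ [-> ->]]]; by exists n0, b0, (Rat s1 s2 s3).
(* Makes [U] single-valued, and later forces two points of one open set into the same ball. *)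
have Wuniq m a q a' q' : W m a q -> W m a' q' -> a = a' /\ q = q'.
  case=> [g|[no [-> ->]]] [g'|[no' [-> ->]]] //.
  - case: g g' => _ [n [b [s [-> _]]]] [_ [n' [b' [s' [mE _]]]]].
    by move: mE => /npair_inj[/npair_inj[/npair_inj[/npair_inj[_ ->] ->]]].
  - by case: no'; exists a, q.
  - by case: no; exists a', q'.
have Wex m : exists a q, W m a q.
  case: (pselect (exists a q, good P p0 m a q)) => [[a [q H]]|H].
    by exists a, q; left.
  by exists a0, c0; right.
have [|Q [QR [Q0 QL]]] := leb U.
  split; first split.
  - move=> z zU; have [m [k [a [q zE]]]] := U1 z zU.
    exists (npair m k), (npair a q); split=> //; split; first by exists m, k.
    exists a, q; split=> //; move: zU; rewrite zE => /U2/WP[n [b [s [H _]]]].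
    by have [] := codeP _ _ _ _ _ H.
  - split=> [z [m [k ->]]|z y y' zy zy'].
      by have [a [q H]] := Wex m; exists (npair a q); apply/U2.
    have [m [k [a [q zE]]]] := U1 _ zy; have [m' [k' [a' [q' zE']]]] := U1 _
      zy'.
    move: zE zE' => /npair_inj[E1 yE] /npair_inj[E2 yE']; rewrite E1 in E2 zy
      zy'.
    rewrite yE yE' in zy zy' *; have := Wuniq _ _ _ _ _ ((U2 _ _ _ _).1 zy)
      ((U2 _ _ _ _).1 zy').
    by case=> -> ->.
  - move=> X XP.
    have [a [b [m1 [m2 [m3 [r'0 [t1 [t2 [t3 [t0 [[n cr] [Xa sq]]]]]]]]]]]] :=
      P5 X XP _ _ _ q0P.
    (* The open set containing the point is indexed by the code of the entry of [P] itself; 0 is an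
       arbitrary position in its constant sequence of balls. *)
    set z := npair _ _ in cr; exists z, dzero, a, m1, m2, m3; do 2![split=> //].
    by apply/U2; left; split=> //; exists n, b, (Rat t1 t2 t3).
exists Q; do 2![split=> //]; move=> X XP Y YP FX FXP FY FYP vX vY XY.
have [n nU] := QL X XP; have [w rw] := reads_set QR.1.
have [x px] := point_seq_ex dδ XP.
have [kx [a [m1 [m2 [m3 [rP [/U2 Wx Xa]]]]]]] :=
  nU X XP (pdist_refl_lt dδ px rw QR.2 Q0).
have [ky [a' [m1' [m2' [m3' [_ [/U2 Wy Ya]]]]]]] := nU Y YP XY.
have [aE /rcode_inj rE] := Wuniq _ _ _ _ _ Wx Wy; rewrite -aE -rE in Ya.
have [m [b [s [cr sq]]]] := WP _ _ _ Wx; have [_ bB _ sP] := codeP _ _ _ _ _ cr.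
case: s sq sP cr => t1 t2 t3 sq sP cr.
have abP : CodeRel P a (Rat m1 m2 m3) b (Rat t1 t2 t3) by exists m.
have {}vX := vX a b _ _ _ rP _ _ _ sP abP Xa.
have {}vY := vY a b _ _ _ rP _ _ _ sP abP Ya.
have [fx pfx] := point_seq_ex dδ' FXP; have [fy pfy] := point_seq_ex dδ' FYP.
have [s'0 _] := rat_posP_gt0 sP; have [q'0 _] := rat_posP_gt0 q0P.
have [k kP] := pdist_lt_near dδ' pfx bB s'0 vX.
have [k' k'P] := pdist_lt_near dδ' pfy bB s'0 vY.
apply: (near_pdist_lt dδ' pfx pfy bB kP k'P rv_eps epsR.2 vl).
by rewrite -q0E; apply/(rat_ltE s'0 q'0).
Qed.
End Main.

Theorem theorem6p1 :
  RCA0_proves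
    (ALL2 A d, IsSpace A d ⇒ Lebesgue A d ⇒ Atsuji A d)%fm.
Proof.
apply: (completeness RCA0_subst) => M MP e f; apply/holdsE/holds_statement.
move=> A d spA leb B d' spB P cP eps epsR.
pose M' := Rca MP (f 0%N).
(* The graph of the powers of 2 is read off from the hypothesis that [eps] is a real: its rapid
   convergence, already at indices 0 and 0, mentions [Pow2] and so provides such a set. *)
have [_ /(_ dzero dzero)[_ [[E [E1 [E2 [E3 _]]]] _]]] := epsR.
have HE : @doubling M' E by [].
exact: (@lebesgue_atsuji M' E HE A d spA leb B d' spB P cP eps epsR).
Qed.
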